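(* The operad $\mathbb{P}_\nearrow$ is Koszul.
   Context: Operads are symmetric operads in vector spaces over a field $K$. $I$ denotes the unit of the operad, and for binary operations $a,b$: $a\circ(b,I)$ is the operation $(x,y,z)\mapsto a(b(x,y),z)$, and $a\circ(I,b)$ is $(x,y,z)\mapsto a(x,b(y,z))$. The operad $\mathbb{P}_\nearrow$ is the quadratic operad generated by two binary operations $m$ and $\nearrow$ (with no symmetry imposed, i.e. the generating $S_2$-module is free with basis $\{m,\nearrow\}$) with the relations $$\nearrow\circ(\nearrow,I)=\nearrow\circ(I,\nearrow),\qquad \nearrow\circ(I,m)=m\circ(\nearrow,I),\qquad m\circ(m,I)=m\circ(I,m).$$ ''Koszul'' is meant in the sense of Ginzburg and Kapranov for quadratic operads. *)

(* Defs.v *)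
From HB Require Import structures.
From mathcomp Require Import all_boot all_order all_algebra all_fingroup.
From mathcomp Require Import generic_quotient ring_quotient zify.
From mathcomp Require Import boolp.

Set Implicit Arguments.
Unset Strict Implicit.
Unset Printing Implicit Defensive.

Import GRing.Theory.
Local Open Scope ring_scope.

Definition permn n (s : 'S_n) (i : nat) : nat :=
  if insub i is Some o then nat_of_ord (s o) else i.

(* Position, among the inputs of p o_i q with q of arity m, of the input
   number j <> i of p; input number j of q has position i + j. *)
Definition outer (m i j : nat) : nat := if (j < i)%N then j else (j + m).-1.

(* Symmetric operads in K-vector spaces, presented by partial compositions:
     (act s p)(x_0, ..., x_(n-1)) = p(x_(s 0), ..., x_(s (n-1))),
     comp i p q = p(x_0, ..., x_(i-1), q(x_i, ..., x_(i+m-1)), x_(i+m), ...).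
   Since (s * t) i = t (s i), [act] is written as a right action. *)
Record operad (K : fieldType) := Operad {
  op :> nat -> lmodType K;
  act : forall n, 'S_n -> op n -> op n;
  one : op 1;
  comp : forall k m, 'I_k -> op k -> op m -> op (k + m).-1;
  act_linear : forall n (s : 'S_n), linear (act s);
  act1 : forall n (p : op n), act 1%g p = p;
  actM : forall n (s t : 'S_n) (p : op n), act (s * t)%g p = act t (act s p);
  comp_linearl : forall k m (i : 'I_k) (q : op m),
    linear (fun p : op k => comp i p q);
  comp_linearr : forall k m (i : 'I_k) (p : op k),
    linear (fun q : op m => comp i p q);
  comp_onel : forall m (q : op m) (e : (1 + m).-1 = m),
    ecast n (op n) e (comp ord0 one q) = q;
  comp_oner : forall k (i : 'I_k) (p : op k) (e : (k + 1).-1 = k),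
    ecast n (op n) e (comp i p one) = p;
  comp_seq : forall k m n (i : 'I_k) (j : 'I_m) (l : 'I_(k + m).-1)
      (p : op k) (q : op m) (r : op n)
      (e : ((k + m).-1 + n).-1 = (k + (m + n).-1).-1),
    l = (i + j)%N :> nat ->
    ecast n (op n) e (comp l (comp i p q) r) = comp i p (comp j q r);
  comp_par : forall k m n (i j : 'I_k)
      (i' : 'I_(k + n).-1) (j' : 'I_(k + m).-1)
      (p : op k) (q : op m) (r : op n)
      (e : ((k + m).-1 + n).-1 = ((k + n).-1 + m).-1),
    (i < j)%N -> i' = i :> nat -> j' = (j + m).-1 :> nat ->
    ecast n (op n) e (comp j' (comp i p q) r) = comp i' (comp j p r) q;
  comp_act : forall k m (i : 'I_k) (s : 'S_k) (t : 'S_m)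
      (u : 'S_(k + m).-1) (p : op k) (q : op m),
    (forall j : 'I_k, j != i ->
       permn u (outer m i j) = outer m (s i) (s j)) ->
    (forall j : 'I_m, permn u (i + j)%N = (s i + t j)%N) ->
    comp (s i) (act s p) (act t q) = act u (comp i p q)
}.

Section Terms.
Variable G : Type.

Inductive term := Lf of nat | Nd of G & term & term.

Fixpoint labels t :=
  match t with Lf l => [:: l] | Nd _ t u => labels t ++ labels u end.

Fixpoint bind t (f : nat -> term) :=
  match t with Lf l => f l | Nd g t u => Nd g (bind t f) (bind u f) end.

Definition relabel f t := bind t (fun l => Lf (f l)).

Definition graft i m s t :=
  bind s (fun j => if j == i then relabel (addn i) t else Lf (outer m i j)).

Lemma eq_in_bind t f g : {in labels t, f =1 g} -> bind t f = bind t g.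
Proof.
elim: t => [l|a t IHt u IHu] /= H; first by apply: H; rewrite inE.
by rewrite IHt ?IHu // => l Hl; apply: H; rewrite mem_cat Hl ?orbT.
Qed.

Lemma bindA t f g : bind (bind t f) g = bind t (fun l => bind (f l) g).
Proof. by elim: t => //= a t -> u ->. Qed.

Lemma bind_Lf t : bind t Lf = t.
Proof. by elim: t => //= a t -> u ->. Qed.

Lemma labels_bind t f :
  labels (bind t f) = flatten [seq labels (f l) | l <- labels t].
Proof.
elim: t => [l|a t IHt u IHu] /=; first by rewrite cats0.
by rewrite map_cat flatten_cat IHt IHu.
Qed.

Lemma labels_relabel t f : labels (relabel f t) = map f (labels t).
Proof.
by rewrite labels_bind; elim: (labels t) => //= a s ->.
Qed.

End Terms.

Section TermTypes.
Variable G : countType.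

Fixpoint term_enc (t : term G) : GenTree.tree (nat + G) :=
  match t with
  | Lf l => GenTree.Leaf (inl l)
  | Nd g t u =>
      GenTree.Node 0 [:: GenTree.Leaf (inr g); term_enc t; term_enc u]
  end.

Fixpoint term_dec (t : GenTree.tree (nat + G)) : option (term G) :=
  match t with
  | GenTree.Leaf (inl l) => Some (Lf G l)
  | GenTree.Node _ [:: GenTree.Leaf (inr g); t; u] =>
      if (term_dec t, term_dec u) is (Some t', Some u') then Some (Nd g t' u')
      else None
  | _ => None
  end.

Lemma term_encK : pcancel term_enc term_dec.
Proof. by elim=> //= g t -> u ->. Qed.

HB.instance Definition _ := Countable.copy (term G) (pcan_type term_encK).
End TermTypes.

Section Monomials.
Variables (G : finType) (n : nat).

Definition multilinear (t : term G) := perm_eq (labels t) (iota 0 n).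

Definition mono := {t : term G | multilinear t}.
HB.instance Definition _ := Countable.on mono.

Fixpoint terms_upto (d : nat) : seq (term G) :=
  if d is d'.+1 then
    terms_upto d' ++
    [seq Nd g tu.1 tu.2 | g <- enum G,
                          tu <- allpairs pair (terms_upto d') (terms_upto d')]
  else [seq Lf G l | l <- iota 0 n].

Lemma terms_upto_le d d' : (d <= d')%N -> {subset terms_upto d <= terms_upto d'}.
Proof.
move=> /subnK <-; elim: (d' - d)%N => // e IHe t /IHe.
by rewrite addSn /= mem_cat => ->.
Qed.

Lemma mem_terms_upto t :
  {subset labels t <= iota 0 n} -> t \in terms_upto (size (labels t)).-1.
Proof.
elim: t => [l|g t IHt u IHu] H.
  by apply: map_f; apply: H; rewrite inE.
have size_gt0 (v : term G) : (0 < size (labels v))%N.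
  by elim: v => //= a v Hv w Hw; rewrite size_cat addn_gt0 Hv.
have Ht : t \in terms_upto (size (labels t)).-1.
  by apply: IHt => l Hl; apply: H; rewrite /= mem_cat Hl.
have Hu : u \in terms_upto (size (labels u)).-1.
  by apply: IHu => l Hl; apply: H; rewrite /= mem_cat Hl orbT.
have := size_gt0 t; have := size_gt0 u => gu gt.
have -> : (size (labels (Nd g t u))).-1
  = ((size (labels t)).-1 + (size (labels u)).-1).+1.
  by rewrite /= size_cat; lia.
rewrite /= mem_cat; apply/orP; right.
apply/allpairsP; exists (g, (t, u)); split=> //=; first by rewrite mem_enum.
apply/allpairsP; exists (t, u); split=> //=.
  by apply: terms_upto_le Ht; rewrite leq_addr.
by apply: terms_upto_le Hu; rewrite leq_addl.
Qed.

Definition mono_enum : seq mono := undup (pmap insub (terms_upto n)).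

Lemma mono_enumP : Finite.axiom mono_enum.
Proof.
apply: Finite.uniq_enumP; first exact: undup_uniq.
move=> [t Ht]; rewrite mem_undup mem_pmap_sub /=.
have sz : size (labels t) = n by rewrite (perm_size Ht) size_iota.
have := @mem_terms_upto t; rewrite sz => H.
rewrite (terms_upto_le (leq_pred n)) //; apply: H => l.
by rewrite (perm_mem Ht).
Qed.

HB.instance Definition _ := isFinite.Build mono mono_enumP.
End Monomials.

(* The free operad on the free S_2-module with basis G: its arity n component
   has as basis the planar binary trees with vertices labelled in G and leaves
   labelled by a bijection with {0, ..., n-1}; the leaf labelled i stands for
   the i-th input. *)
Section FreeOperad.
Variables (K : fieldType) (G : finType).

Definition free (n : nat) : lmodType K := {ffun mono G n -> K^o}.

Definition mon (n : nat) (t : term G) : free n :=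
  [ffun w : mono G n => (val w == t)%:R].

Definition extend n (V : lmodType K) (f : term G -> V) (x : free n) : V :=
  \sum_(w : mono G n) (x w : K) *: f (val w).

Definition free_act n (s : 'S_n) : free n -> free n :=
  extend (fun t => mon n (relabel (permn s) t)).

Definition free_one : free 1 := mon 1 (Lf G 0).

Definition free_comp k m (i : 'I_k) (x : free k) (y : free m) :
    free (k + m).-1 :=
  extend (fun s => extend (fun t => mon _ (graft i m s t)) y) x.

Lemma extend_linear n (V : lmodType K) (f : term G -> V) : linear (@extend n V f).
Proof.
move=> a x y; rewrite /extend scaler_sumr -big_split /=.
by apply: eq_bigr => w _; rewrite !ffunE scalerDl scalerA.
Qed.

Lemma extend_mon n (V : lmodType K) (f : term G -> V) t :
  multilinear n t -> extend f (mon n t) = f t.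
Proof.
move=> Ht; rewrite /extend (bigD1 (exist _ t Ht : mono G n)) //= ffunE eqxx scale1r.
rewrite big1 ?addr0 // => w; rewrite ffunE -val_eqE /= => /negPf ->.
by rewrite scale0r.
Qed.

Lemma extendE n (x : free n) : x = extend (mon n) x.
Proof.
apply/ffunP => w; rewrite /extend sum_ffunE (bigD1 w) //= !ffunE eqxx.
rewrite big1 ?addr0; first by rewrite /GRing.scale /= mulr1.
move=> v; rewrite !ffunE eq_sym val_eqE => /negPf ->.
exact: (mulr0 (x v : K)).
Qed.

Lemma eq_extend n (V : lmodType K) (f g : term G -> V) (x : free n) :
  (forall t, multilinear n t -> f t = g t) -> extend f x = extend g x.
Proof. by move=> H; apply: eq_bigr => w _; rewrite H // (valP w). Qed.

Lemma extend_lincomb n (V : lmodType K) (f g h : term G -> V) a (x : free n) :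
  (forall t, f t = a *: g t + h t) ->
  extend f x = a *: extend g x + extend h x.
Proof.
move=> H; rewrite /extend scaler_sumr -big_split /=; apply: eq_bigr => w _.
by rewrite H scalerDr !scalerA mulrC.
Qed.

Lemma linear_extend n (V W : lmodType K) (h : V -> W) (f : term G -> V)
    (x : free n) :
  linear h -> h (extend f x) = extend (fun t => h (f t)) x.
Proof.
move=> Lh; pose hM := GRing.isLinear.Build _ _ _ _ _ Lh.
pose hL : {linear V -> W} := HB.pack h hM.
apply: etrans (linear_sum hL _ _ _) _; apply: eq_bigr => w _.
exact: (linearZ_LR hL).
Qed.

Lemma linear_ext n (V : lmodType K) (h h' : free n -> V) :
  linear h -> linear h' ->
  (forall t, multilinear n t -> h (mon n t) = h' (mon n t)) -> h =1 h'.
Proof.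
move=> Lh Lh' H x; rewrite (extendE x) !linear_extend //.
exact: eq_extend.
Qed.

Lemma comp_fun_linear (U V W : lmodType K) (f : U -> V) (g : V -> W) :
  linear f -> linear g -> linear (fun x => g (f x)).
Proof. by move=> Lf Lg a x y; rewrite Lf Lg. Qed.

Lemma cast_linear m n (e : m = n) (V : lmodType K) (f : V -> free m) :
  linear f -> linear (fun x => ecast k (free k) e (f x)).
Proof. by case: n / e. Qed.

Lemma cast_mon m n (e : m = n) t : ecast k (free k) e (mon m t) = mon n t.
Proof. by case: n / e. Qed.

Lemma free_act_linear n (s : 'S_n) : linear (free_act s).
Proof. exact: extend_linear. Qed.

Lemma free_comp_linearl k m (i : 'I_k) (q : free m) :
  linear (fun p : free k => free_comp i p q).
Proof. exact: extend_linear. Qed.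

Lemma free_comp_linearr k m (i : 'I_k) (p : free k) :
  linear (fun q : free m => free_comp i p q).
Proof.
move=> a x y; apply: extend_lincomb => t.
exact: extend_linear.
Qed.

Lemma permnE n (s : 'S_n) (o : 'I_n) : permn s o = s o.
Proof. by rewrite /permn valK. Qed.

Lemma multilinearP n (t : term G) l :
  multilinear n t -> (l \in labels t) = (l < n)%N.
Proof. by move=> Ht; rewrite (perm_mem Ht) mem_iota. Qed.

Lemma relabel_multilinear n (s : 'S_n) (t : term G) :
  multilinear n t -> multilinear n (relabel (permn s) t).
Proof.
move=> Ht; rewrite /multilinear labels_relabel.
apply: (perm_trans (perm_map _ Ht)).
rewrite -val_enum_ord -map_comp (eq_map (g := val \o s)); last first.
  by move=> o; rewrite /= permnE.
rewrite map_comp; apply: perm_map; apply: uniq_perm.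
- by rewrite map_inj_uniq ?enum_uniq //; apply: perm_inj.
- exact: enum_uniq.
move=> o; rewrite mem_enum inE; apply/mapP; exists ((s^-1)%g o).
  by rewrite mem_enum.
by rewrite permKV.
Qed.

Lemma graft_multilinear k m i (s t : term G) : (i < k)%N ->
  multilinear k s -> multilinear m t ->
  multilinear (k + m).-1 (graft i m s t).
Proof.
move=> ik Hs Ht; rewrite /multilinear labels_bind.
set d := (k - i.+1)%N; have dE : k = (i + d.+1)%N by rewrite /d; lia.
apply: (@perm_trans _ (flatten [seq labels
  (if j == i then relabel (addn i) t else Lf G (outer m i j)) | j <- iota 0 k])).
  by apply: perm_flatten; apply: perm_map.
have -> : iota 0 k = iota 0 i ++ i :: iota i.+1 d.
  by rewrite dE iotaD add0n.
rewrite map_cat flatten_cat /= eqxx labels_relabel.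
have -> : iota 0 (k + m).-1
   = iota 0 i ++ iota i m ++ iota (i + m)%N d.
  have -> : (k + m).-1 = (i + (m + d))%N by rewrite dE; lia.
  by rewrite iotaD add0n iotaD.
apply: perm_cat.
  rewrite (_ : flatten _ = iota 0 i) // -[RHS]flatten_seq1.
  congr flatten; apply/eq_in_map => j; rewrite mem_iota add0n => /andP[_ ji].
  by rewrite ltn_eqF //= /outer ji.
apply: perm_cat.
  by rewrite -{2}[i]addn0 iotaDl; apply: perm_map.
rewrite (_ : flatten _ = iota (i + m)%N d) //.
have -> : iota (i + m)%N d
  = [seq (j + m).-1 | j <- iota i.+1 d].
  rewrite -(addn0 (i + m)%N) -(addn0 i.+1) !iotaDl -map_comp.
  by apply: eq_map => j /=; lia.
rewrite -[RHS]flatten_seq1 -map_comp; congr flatten; apply/eq_in_map => j.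
rewrite mem_iota => /andP[ij _] /=.
by rewrite gtn_eqF //= /outer ltnNge ltnW.
Qed.

Lemma free_comp_mon k m (i : 'I_k) s t :
  multilinear k s -> multilinear m t ->
  free_comp i (mon k s) (mon m t) = mon _ (graft i m s t).
Proof. by move=> Hs Ht; rewrite /free_comp !extend_mon. Qed.

Lemma free_act_mon n (s : 'S_n) t :
  multilinear n t -> free_act s (mon n t) = mon n (relabel (permn s) t).
Proof. exact: extend_mon. Qed.

Lemma one_multilinear : multilinear 1 (Lf G 0).
Proof. by []. Qed.

Lemma free_act1 n (p : free n) : free_act 1%g p = p.
Proof.
apply: (linear_ext (h := free_act 1%g) (h' := id)) => //.
  exact: free_act_linear.
move=> t Ht; rewrite free_act_mon //; congr mon.
rewrite -[RHS]bind_Lf; apply: eq_in_bind => l _.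
by rewrite /permn; case: insubP => // o _ <-; rewrite perm1.
Qed.

Lemma free_actM n (s t : 'S_n) (p : free n) :
  free_act (s * t)%g p = free_act t (free_act s p).
Proof.
apply: (linear_ext (h := free_act (s * t)%g)
          (h' := fun p => free_act t (free_act s p))) => //.
- exact: free_act_linear.
- by apply: comp_fun_linear; apply: free_act_linear.
move=> w Hw; rewrite !free_act_mon //; last exact: relabel_multilinear.
congr mon; rewrite /relabel bindA; apply: eq_in_bind => l.
rewrite (multilinearP _ Hw) => ln /=; rewrite -[l]/(val (Ordinal ln)).
by rewrite !permnE permM.
Qed.

Lemma free_comp_onel m (q : free m) (e : (1 + m).-1 = m) :
  ecast n (free n) e (free_comp ord0 free_one q) = q.
Proof.
apply: (linear_ext (h := fun q => ecast n (free n) e (free_comp ord0 free_one q))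
          (h' := id)) => //.
  by apply: cast_linear; apply: free_comp_linearr.
move=> t Ht; rewrite free_comp_mon // cast_mon; congr mon.
by rewrite /graft /=; apply: bind_Lf.
Qed.

Lemma free_comp_oner k (i : 'I_k) (p : free k) (e : (k + 1).-1 = k) :
  ecast n (free n) e (free_comp i p free_one) = p.
Proof.
apply: (linear_ext (h := fun p => ecast n (free n) e (free_comp i p free_one))
          (h' := id)) => //.
  by apply: cast_linear; apply: free_comp_linearl.
move=> t Ht; rewrite free_comp_mon // cast_mon; congr mon.
rewrite /graft -[RHS]bind_Lf; apply: eq_in_bind => l _.
case: eqP => [->|_]; first by rewrite /relabel /= addn0.
by rewrite /outer addn1 if_same.
Qed.

Lemma free_comp_seq k m n (i : 'I_k) (j : 'I_m) (l : 'I_(k + m).-1)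
    (p : free k) (q : free m) (r : free n)
    (e : ((k + m).-1 + n).-1 = (k + (m + n).-1).-1) :
  l = (i + j)%N :> nat ->
  ecast n (free n) e (free_comp l (free_comp i p q) r)
  = free_comp i p (free_comp j q r).
Proof.
move=> Hl; move: p.
apply: linear_ext; [|exact: free_comp_linearl|].
  apply: cast_linear.
  by apply: (comp_fun_linear (free_comp_linearl _ _) (free_comp_linearl _ _)).
move=> s Hs; move: q; apply: linear_ext.
- apply: cast_linear.
  by apply: (comp_fun_linear (free_comp_linearr _ _) (free_comp_linearl _ _)).
- by apply: (comp_fun_linear (free_comp_linearl _ _) (free_comp_linearr _ _)).
move=> t Ht; move: r; apply: linear_ext.
- by apply: cast_linear; apply: free_comp_linearr.
- by apply: (comp_fun_linear (free_comp_linearr _ _) (free_comp_linearr _ _)).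
move=> u Hu; have Hst := graft_multilinear (ltn_ord i) Hs Ht.
have Htu := graft_multilinear (ltn_ord j) Ht Hu.
rewrite !free_comp_mon // cast_mon; congr mon.
rewrite /graft bindA; apply: eq_in_bind => a.
rewrite (multilinearP _ Hs) => ak.
have [_|ai] := eqVneq a (i : nat).
  rewrite /relabel !bindA; apply: eq_in_bind => b.
  rewrite (multilinearP _ Ht) => bm /=.
  rewrite Hl eqn_add2l; case: eqVneq => bj.
    rewrite /relabel bindA; apply: eq_in_bind => c _ /=.
    by congr Lf; lia.
  by rewrite /= /outer ltn_add2l; congr Lf; case: ifP; lia.
rewrite /= ifN; last by rewrite Hl /outer; have := ltn_ord j; case: ifP; lia.
by congr Lf; rewrite Hl /outer; have := ltn_ord j;
   case: (ltnP a i) => ? ?; case: ifP; lia.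
Qed.

Lemma free_comp_par k m n (i j : 'I_k)
    (i' : 'I_(k + n).-1) (j' : 'I_(k + m).-1)
    (p : free k) (q : free m) (r : free n)
    (e : ((k + m).-1 + n).-1 = ((k + n).-1 + m).-1) :
  (i < j)%N -> i' = i :> nat -> j' = (j + m).-1 :> nat ->
  ecast n (free n) e (free_comp j' (free_comp i p q) r)
  = free_comp i' (free_comp j p r) q.
Proof.
move=> ij Hi' Hj'; move: p; apply: linear_ext.
- apply: cast_linear.
  by apply: (comp_fun_linear (free_comp_linearl _ _) (free_comp_linearl _ _)).
- by apply: (comp_fun_linear (free_comp_linearl _ _) (free_comp_linearl _ _)).
move=> s Hs; move: q; apply: linear_ext.
- apply: cast_linear.
  by apply: (comp_fun_linear (free_comp_linearr _ _) (free_comp_linearl _ _)).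
- exact: free_comp_linearr.
move=> t Ht; move: r; apply: linear_ext.
- by apply: cast_linear; apply: free_comp_linearr.
- by apply: (comp_fun_linear (free_comp_linearr _ _) (free_comp_linearl _ _)).
move=> u Hu; have Hst := graft_multilinear (ltn_ord i) Hs Ht.
have Hsu := graft_multilinear (ltn_ord j) Hs Hu.
rewrite !free_comp_mon // cast_mon; congr mon.
rewrite /graft !bindA; apply: eq_in_bind => a.
rewrite (multilinearP _ Hs) => ak; rewrite Hi' Hj'.
have [->|ai] := eqVneq a (i : nat).
  rewrite ltn_eqF //= /outer ij eqxx /relabel bindA.
  apply: eq_in_bind => b; rewrite (multilinearP _ Ht) => bm /=.
  rewrite ifN; last by lia.
  by rewrite ifT //; lia.
have [->|aj] := eqVneq a (j : nat).
  rewrite /= /outer ltnNge (ltnW ij) /= eqxx /relabel bindA.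
  apply: eq_in_bind => b; rewrite (multilinearP _ Hu) => bn /=.
  rewrite ifN; last by lia.
  rewrite ifN; last by lia.
  by congr Lf; lia.
rewrite /= /outer.
by case: (ltnP a i) => ?; case: (ltnP a j) => ?; repeat (case: ifP => ?);
   first [congr Lf; lia | exfalso; lia].
Qed.

Lemma free_comp_act k m (i : 'I_k) (s : 'S_k) (t : 'S_m)
    (u : 'S_(k + m).-1) (p : free k) (q : free m) :
  (forall j : 'I_k, j != i ->
     permn u (outer m i j) = outer m (s i) (s j)) ->
  (forall j : 'I_m, permn u (i + j)%N = (s i + t j)%N) ->
  free_comp (s i) (free_act s p) (free_act t q) = free_act u (free_comp i p q).
Proof.
move=> Hout Hin; move: p; apply: linear_ext.
- by apply: (comp_fun_linear (free_act_linear _) (free_comp_linearl _ _)).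
- by apply: (comp_fun_linear (free_comp_linearl _ _) (free_act_linear _)).
move=> v Hv; move: q; apply: linear_ext.
- by apply: (comp_fun_linear (free_act_linear _) (free_comp_linearr _ _)).
- by apply: (comp_fun_linear (free_comp_linearr _ _) (free_act_linear _)).
move=> w Hw; rewrite !free_act_mon // !free_comp_mon //; last 2 first.
- exact: relabel_multilinear.
- exact: relabel_multilinear.
rewrite free_act_mon; last exact: graft_multilinear.
congr mon; rewrite /graft /relabel !bindA; apply: eq_in_bind => a.
rewrite (multilinearP _ Hv) => ak; rewrite -[a]/(nat_of_ord (Ordinal ak)).
move: (Ordinal ak) => o; rewrite [LHS]/= permnE !val_eqE (inj_eq perm_inj).
have [_|oi] := eqVneq o i.
  rewrite !bindA; apply: eq_in_bind => b; rewrite (multilinearP _ Hw) => bm.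
  by rewrite /= -[b]/(val (Ordinal bm)) permnE Hin.
by rewrite /= (Hout o).
Qed.

Definition free_operad : operad K :=
  Operad free_act_linear free_act1 free_actM free_comp_linearl free_comp_linearr
    free_comp_onel free_comp_oner free_comp_seq free_comp_par free_comp_act.

End FreeOperad.

Section QuotientModule.
Variables (K : fieldType) (V : lmodType K) (I : zmodClosed V).
Hypothesis scaleI : forall (a : K) (x : V), x \in I -> a *: x \in I.
Local Open Scope quotient_scope.

(* [scaleI] is a dummy argument: it is what makes the module structure below
   inferable. *)
Definition qmod : Type := let _ := scaleI in Quotient.quot I.
HB.instance Definition _ := GRing.Zmodule.copy qmod (Quotient.quot I).

Definition qpi (x : V) : qmod := \pi_(Quotient.quot I) x.
Definition qrepr (x : qmod) : V := repr (x : Quotient.quot I).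

Lemma qpi_eq x y : qpi x = qpi y <-> x - y \in I.
Proof.
rewrite /qpi Quotient.idealrBE; split => [->|/eqP] //.
Qed.

Lemma qreprK (x : qmod) : qpi (qrepr x) = x.
Proof. exact: reprK. Qed.

Lemma qpiB : zmod_morphism qpi.
Proof. exact: (pi_is_zmod_morphism (Quotient.quot I)). Qed.

Definition qscale (a : K) (x : qmod) : qmod := qpi (a *: qrepr x).

Lemma qscale_pi a x : qscale a (qpi x) = qpi (a *: x).
Proof. by apply/qpi_eq; rewrite -scalerBr; apply/scaleI/qpi_eq/qreprK. Qed.

Lemma qpiD : {morph qpi : x y / x + y}.
Proof.
have q0 : qpi 0 = 0 by rewrite -(subrr 0) qpiB subrr.
by move=> x y; rewrite -[y in LHS]opprK qpiB -(sub0r y) qpiB q0 sub0r opprK.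
Qed.

Fact qscaleA a b x : qscale a (qscale b x) = qscale (a * b) x.
Proof. by rewrite -[x]qreprK !qscale_pi scalerA. Qed.
Fact qscale1 : left_id 1 qscale.
Proof. by move=> x; rewrite -[x]qreprK qscale_pi scale1r. Qed.
Fact qscaleDr : right_distributive qscale +%R.
Proof.
move=> a x y; rewrite -[x]qreprK -[y]qreprK -qpiD !qscale_pi -qpiD.
by rewrite scalerDr.
Qed.
Fact qscaleDl x : {morph qscale^~ x : a b / a + b}.
Proof.
by move=> a b; rewrite -[x]qreprK !qscale_pi -qpiD scalerDl.
Qed.
HB.instance Definition _ :=
  GRing.Zmodule_isLmodule.Build K qmod qscaleA qscale1 qscaleDr qscaleDl.

Lemma qpi_linear : linear qpi.
Proof. by move=> a x y; rewrite qpiD -qscale_pi. Qed.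

End QuotientModule.

Section QuotientOperad.
Variables (K : fieldType) (P : operad K).

Record is_ideal (I : forall n, P n -> Prop) : Prop := IsIdeal {
  ideal0 : forall n, I n 0;
  ideal_lin : forall n a (x y : P n), I n x -> I n y -> I n (a *: x + y);
  ideal_act : forall n (s : 'S_n) (x : P n), I n x -> I n (act s x);
  ideal_compl : forall k m (i : 'I_k) (x : P k) (y : P m),
    I k x -> I _ (comp i x y);
  ideal_compr : forall k m (i : 'I_k) (x : P k) (y : P m),
    I m y -> I _ (comp i x y)
}.

Variable R : forall n, P n -> Prop.

Definition ideal_gen n (x : P n) : Prop :=
  forall I, is_ideal I -> (forall m (y : P m), R y -> I m y) -> I n x.

Lemma ideal_genP : is_ideal ideal_gen.
Proof.
split.
- by move=> n I HI _; apply: ideal0.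
- by move=> n a x y Hx Hy I HI HR; apply: ideal_lin => //; [apply: Hx | apply: Hy].
- by move=> n s x Hx I HI HR; apply: ideal_act => //; apply: Hx.
- by move=> k m i x y Hx I HI HR; apply: ideal_compl => //; apply: Hx.
- by move=> k m i x y Hy I HI HR; apply: ideal_compr => //; apply: Hy.
Qed.

Definition ideal_pred n : pred (P n) := fun x => `[< ideal_gen x >].

Lemma ideal_predP n (x : P n) : (x \in @ideal_pred n) <-> ideal_gen x.
Proof. by rewrite unfold_in /ideal_pred; split=> /asboolP. Qed.

Fact ideal_zmod_closed n : zmod_closed (@ideal_pred n).
Proof.
split; first by apply/ideal_predP; apply: (ideal0 ideal_genP).
move=> x y /ideal_predP Hx /ideal_predP Hy; apply/ideal_predP.
by rewrite addrC -scaleN1r; apply: (ideal_lin ideal_genP).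
Qed.
HB.instance Definition _ n :=
  GRing.isZmodClosed.Build (P n) (@ideal_pred n) (@ideal_zmod_closed n).

Fact ideal_scale n (a : K) (x : P n) :
  x \in @ideal_pred n -> a *: x \in @ideal_pred n.
Proof.
move=> /ideal_predP Hx; apply/ideal_predP; rewrite -[_ *: _]addr0.
by apply: (ideal_lin ideal_genP) => //; apply: (ideal0 ideal_genP).
Qed.

Definition quot n : lmodType K := qmod (@ideal_scale n).

Definition qproj n : P n -> quot n := @qpi K (P n) _ (@ideal_scale n).

Lemma qproj_eq n (x y : P n) : qproj x = qproj y <-> ideal_gen (x - y).
Proof. by rewrite /qproj qpi_eq ideal_predP. Qed.

Lemma qproj_linear n : linear (@qproj n).
Proof. exact: qpi_linear. Qed.

Definition qlift n (x : quot n) : P n := qrepr x.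

Lemma qliftK n (x : quot n) : qproj (qlift x) = x.
Proof. exact: qreprK. Qed.

Definition quot_act n (s : 'S_n) (x : quot n) : quot n :=
  qproj (act s (qlift x)).

Definition quot_comp k m (i : 'I_k) (x : quot k) (y : quot m) :
    quot (k + m).-1 :=
  qproj (comp i (qlift x) (qlift y)).

Lemma linB (V W : lmodType K) (f : V -> W) x y :
  linear f -> f (x - y) = f x - f y.
Proof. by move=> Lf; rewrite addrC -scaleN1r Lf scaleN1r addrC. Qed.

Lemma quot_act_proj n (s : 'S_n) (x : P n) :
  quot_act s (qproj x) = qproj (act s x).
Proof.
apply/qproj_eq; rewrite -(linB _ _ (act_linear s)).
by apply: (ideal_act ideal_genP); apply/qproj_eq/qliftK.
Qed.

Lemma quot_comp_proj k m (i : 'I_k) (x : P k) (y : P m) :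
  quot_comp i (qproj x) (qproj y) = qproj (comp i x y).
Proof.
apply: (@etrans _ _ (qproj (comp i (qlift (qproj x)) y))); apply/qproj_eq.
  rewrite -(linB _ _ (comp_linearr i _)); apply: (ideal_compr ideal_genP).
  by apply/qproj_eq; apply: qliftK.
rewrite -(linB _ _ (comp_linearl i _)); apply: (ideal_compl ideal_genP).
by apply/qproj_eq; apply: qliftK.
Qed.

Lemma quot_cast m n (e : m = n) (x : P m) :
  ecast k (quot k) e (qproj x) = qproj (ecast k (P k) e x).
Proof. by case: n / e. Qed.

Lemma qprojP n (x : quot n) : exists y, x = qproj y.
Proof. by exists (qlift x); rewrite qliftK. Qed.

Lemma quot_act_linear n (s : 'S_n) : linear (quot_act s).
Proof.
move=> a x y; have [x' ->] := qprojP x; have [y' ->] := qprojP y.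
by rewrite -qproj_linear !quot_act_proj act_linear qproj_linear.
Qed.

Lemma quot_act1 n (p : quot n) : quot_act 1%g p = p.
Proof. by have [p' ->] := qprojP p; rewrite quot_act_proj act1. Qed.

Lemma quot_actM n (s t : 'S_n) (p : quot n) :
  quot_act (s * t)%g p = quot_act t (quot_act s p).
Proof. by have [p' ->] := qprojP p; rewrite !quot_act_proj actM. Qed.

Lemma quot_comp_linearl k m (i : 'I_k) (q : quot m) :
  linear (fun p : quot k => quot_comp i p q).
Proof.
move=> a x y; have [x' ->] := qprojP x; have [y' ->] := qprojP y.
have [q' ->] := qprojP q.
by rewrite -qproj_linear !quot_comp_proj comp_linearl qproj_linear.
Qed.

Lemma quot_comp_linearr k m (i : 'I_k) (p : quot k) :
  linear (fun q : quot m => quot_comp i p q).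
Proof.
move=> a x y; have [x' ->] := qprojP x; have [y' ->] := qprojP y.
have [p' ->] := qprojP p.
by rewrite -qproj_linear !quot_comp_proj comp_linearr qproj_linear.
Qed.

Definition quot_one : quot 1 := qproj (one P).

Lemma quot_comp_onel m (q : quot m) (e : (1 + m).-1 = m) :
  ecast n (quot n) e (quot_comp ord0 quot_one q) = q.
Proof.
by have [q' ->] := qprojP q; rewrite quot_comp_proj quot_cast comp_onel.
Qed.

Lemma quot_comp_oner k (i : 'I_k) (p : quot k) (e : (k + 1).-1 = k) :
  ecast n (quot n) e (quot_comp i p quot_one) = p.
Proof.
by have [p' ->] := qprojP p; rewrite quot_comp_proj quot_cast comp_oner.
Qed.

Lemma quot_comp_seq k m n (i : 'I_k) (j : 'I_m) (l : 'I_(k + m).-1)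
    (p : quot k) (q : quot m) (r : quot n)
    (e : ((k + m).-1 + n).-1 = (k + (m + n).-1).-1) :
  l = (i + j)%N :> nat ->
  ecast n (quot n) e (quot_comp l (quot_comp i p q) r)
  = quot_comp i p (quot_comp j q r).
Proof.
have [p' ->] := qprojP p; have [q' ->] := qprojP q.
have [r' ->] := qprojP r => Hl.
by rewrite !quot_comp_proj quot_cast (comp_seq p' q' r' e Hl).
Qed.

Lemma quot_comp_par k m n (i j : 'I_k)
    (i' : 'I_(k + n).-1) (j' : 'I_(k + m).-1)
    (p : quot k) (q : quot m) (r : quot n)
    (e : ((k + m).-1 + n).-1 = ((k + n).-1 + m).-1) :
  (i < j)%N -> i' = i :> nat -> j' = (j + m).-1 :> nat ->
  ecast n (quot n) e (quot_comp j' (quot_comp i p q) r)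
  = quot_comp i' (quot_comp j p r) q.
Proof.
have [p' ->] := qprojP p; have [q' ->] := qprojP q.
have [r' ->] := qprojP r => ij Hi Hj.
by rewrite !quot_comp_proj quot_cast (comp_par p' q' r' e ij Hi Hj).
Qed.

Lemma quot_comp_act k m (i : 'I_k) (s : 'S_k) (t : 'S_m)
    (u : 'S_(k + m).-1) (p : quot k) (q : quot m) :
  (forall j : 'I_k, j != i ->
     permn u (outer m i j) = outer m (s i) (s j)) ->
  (forall j : 'I_m, permn u (i + j)%N = (s i + t j)%N) ->
  quot_comp (s i) (quot_act s p) (quot_act t q) = quot_act u (quot_comp i p q).
Proof.
have [p' ->] := qprojP p; have [q' ->] := qprojP q => Hout Hin.
rewrite (quot_act_proj s) (quot_act_proj t) !quot_comp_proj quot_act_proj.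
by rewrite (comp_act p' q' Hout Hin).
Qed.

Definition quot_operad : operad K :=
  Operad quot_act_linear quot_act1 quot_actM quot_comp_linearl quot_comp_linearr
    quot_comp_onel quot_comp_oner quot_comp_seq quot_comp_par quot_comp_act.

End QuotientOperad.

(* The cobar complex D(P)(n) of an operad P with P(0) = 0, P(1) = K and finite
   dimensional components.  In degree j it is the sum, over the isomorphism
   classes of reduced trees T with leaves labelled by {0, ..., n-1} and j
   internal edges, of P(T)^* (x) det(T), where P(T) is the tensor product of the
   P(In(v)) over the vertices v of T and det(T) is the top exterior power of the
   space spanned by the internal edges.  An element of it is given by its values
   on planar trees with vertices decorated by elements of P and with internal
   edges numbered 0, ..., j-1, the numbering standing for e_0 /\ ... /\ e_(j-1);
   see [cochain]. *)
Section Cobar.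
Variables (K : fieldType) (P : operad K).

Inductive child (T : Type) := Leaf of nat | Edge of nat & T.

Inductive tree := Vtx (k : nat) of P k & seq (child tree).

Definition is_edge (e : nat) (c : child tree) : bool :=
  if c is Edge e' _ then e == e' else false.

Fixpoint leaves (t : tree) : seq nat :=
  let: Vtx _ _ s := t in
  flatten [seq match c with Leaf l => [:: l] | Edge _ u => leaves u end | c <- s].

Fixpoint edges (t : tree) : seq nat :=
  let: Vtx _ _ s := t in
  flatten [seq match c with Leaf _ => [::] | Edge e u => e :: edges u end | c <- s].

Fixpoint reduced (t : tree) : bool :=
  let: Vtx k _ s := t in
  [&& (1 < k)%N, size s == k
    & all (fun c => if c is Edge _ u then reduced u else true) s].

Definition is_tree (n j : nat) (t : tree) : bool :=
  [&& reduced t, perm_eq (leaves t) (iota 0 n) & perm_eq (edges t) (iota 0 j)].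

Fixpoint renumber (f : nat -> nat) (t : tree) : tree :=
  let: Vtx k p s := t in
  Vtx p [seq match c with
             | Leaf l => Leaf _ l
             | Edge e u => Edge (f e) (renumber f u)
             end | c <- s].

Fixpoint contract (e : nat) (t : tree) : tree :=
  let: Vtx k p s := t in
  let i := find (is_edge e) s in
  match nth (Leaf _ 0) s i, insub i with
  | Edge _ (Vtx m q s'), Some o =>
      Vtx (comp (o : 'I_k) p q) (take i s ++ s' ++ drop i.+1 s)
  | _, _ =>
      Vtx p [seq match c with
                 | Leaf l => Leaf _ l
                 | Edge e' u => Edge e' (contract e u)
                 end | c <- s]
  end.

Inductive context :=
  | Hole
  | Above (k : nat) of P k & seq (child tree) & nat & context & seq (child tree).

Fixpoint fill (C : context) (t : tree) : tree :=
  match C with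
  | Hole => t
  | Above k p s e C' s' => Vtx p (s ++ Edge e (fill C' t) :: s')
  end.

(* The three clauses say that phi is multilinear in the decorations, that it is
   compatible with tree isomorphisms (reordering the inputs of a vertex v amounts
   to the action of the symmetric group on P(In(v))), and that it is alternating
   in the numbering of the internal edges. *)
Record cochain (n j : nat) (phi : tree -> K) : Prop := Cochain {
  cochain_linear : forall C k (a : K) (p q : P k) s,
    is_tree n j (fill C (Vtx p s)) ->
    phi (fill C (Vtx (a *: p + q) s))
    = a * phi (fill C (Vtx p s)) + phi (fill C (Vtx q s));
  cochain_iso : forall C k (g : 'S_k) (p : P k) s,
    is_tree n j (fill C (Vtx p s)) ->
    phi (fill C (Vtx (act g p) s))
    = phi (fill C (Vtx p [seq nth (Leaf _ 0) s (g i) | i <- enum 'I_k]));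
  cochain_alt : forall (g : 'S_j) t,
    is_tree n j t -> phi (renumber (permn g) t) = (-1) ^+ g * phi t
}.

(* Transpose of e_0 /\ ... /\ e_j |->
   \sum_i (-1)^i (contraction of e_i) e_0 /\ .. (omit e_i) .. /\ e_j. *)
Definition cobar_d (phi : tree -> K) (t : tree) : K :=
  \sum_(i < size (edges t))
    (-1) ^+ i * phi (renumber (unbump i) (contract i t)).

Definition is_cocycle (n j : nat) (phi : tree -> K) : Prop :=
  forall t, is_tree n j.+1 t -> cobar_d phi t = 0.

Definition is_coboundary (n j : nat) (phi : tree -> K) : Prop :=
  if j is j'.+1 then
    exists2 psi, cochain n j' psi &
      forall t, is_tree n j t -> phi t = cobar_d psi t
  else forall t, is_tree n 0 t -> phi t = 0.

(* A binary generated quadratic operad P is Koszul when D(P) -> P^! is a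
   quasi-isomorphism, i.e. when each complex D(P)(n) is exact everywhere but at
   its right end, which is the degree j = n - 2 of binary trees. *)
Definition koszul : Prop :=
  forall n j, (j.+2 < n)%N -> forall phi : tree -> K,
    cochain n j phi -> is_cocycle n j phi -> is_coboundary n j phi.

End Cobar.

Inductive generator := gen_m | gen_ne.

Definition bool_of_generator g := if g is gen_m then true else false.
Definition generator_of_bool b := if b then gen_m else gen_ne.
Lemma bool_of_generatorK : cancel bool_of_generator generator_of_bool.
Proof. by case. Qed.
HB.instance Definition _ := Finite.copy generator (can_type bool_of_generatorK).

Section PNe.
Variable K : fieldType.
Local Notation F := (free_operad K generator).

Definition gen (g : generator) : F 2 := mon K 2 (Nd g (Lf _ 0) (Lf _ 1)).
Local Notation m := (gen gen_m).
Local Notation ne := (gen gen_ne).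

(* a o (b, I) and a o (I, b) *)
Definition compL (a b : F 2) : F 3 := comp (ord0 : 'I_2) a b.
Definition compR (a b : F 2) : F 3 := comp (ord_max : 'I_2) a b.

Inductive relation_ne : forall n, F n -> Prop :=
  | ne_ne : relation_ne (compL ne ne - compR ne ne)
  | ne_m : relation_ne (compR ne m - compL m ne)
  | m_m : relation_ne (compL m m - compR m m).

Definition P_ne : operad K := quot_operad relation_ne.

End PNe.

(* Main.v *)
(* The three relations read (x a y) b z = x a (y b z) for every pair (a, b) of
   generators other than (m, ne).  Since these pairs form a transitive relation,
   orienting them from left to right is confluent, and P_ne has a basis of normal
   binary trees.  Decorating the vertices of a tree by normal trees amounts to
   marking ("cutting") some edges of one binary tree, all its reducible edges
   included; an edge is then contracted by unmarking it and normalizing.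
   Unmarking a reducible edge lowers a rank, while unmarking another edge leaves
   the binary tree as it is.  So in each rank the cobar differential is, modulo
   lower rank, that of a simplex on the nonreducible edges: toggling the first
   such edge is a contracting homotopy, and it is missing only when every edge is
   reducible, that is, marked, which happens in the top degree n - 2 only. *)
From HB Require Import structures.
From mathcomp Require Import all_boot all_order all_algebra all_fingroup zify.
From mathcomp Require Import boolp.
Require Import Defs.

Set Implicit Arguments.
Unset Strict Implicit.
Unset Printing Implicit Defensive.

Import GRing.Theory.
Local Open Scope ring_scope.

(** The decorations are arbitrary classes in a quotient, and no basis of [P_ne] is ever built. A
    tree is read instead as a linear form on functions of marked terms, its expansion ([eval_tree]).
    That normal trees are independent becomes the fact that this form respects the relations; that
    they span becomes the fact that a cochain is determined, through the expansion, by its values on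
    the trees [cut_tree K t]. Together these turn cochains into alternating functions on [valid]
    terms, and the cobar differential into [delta]. On marked terms the obstacle is that the
    toggling homotopy is exact only modulo lower rank. It is therefore used one rank at a time, on a
    cochain that already vanishes below that rank. Moreover the edge to toggle must be found without
    looking at any mark, so that it stays the same edge when other marks are removed or
    renumbered. *)

Definition rassoc (a b : generator) : bool :=
  if (a, b) is (gen_m, gen_ne) then false else true.

Lemma rassoc_trans a b c : rassoc a b -> rassoc b c -> rassoc a c.
Proof. by case: a b c => [] [] []. Qed.

(* The mark of a node is the number of the edge above it if that edge is cut, and
   None if it is interior to a vertex; the mark of the root is None. *)
Definition mterm := term (option nat * generator).

Definition mark (t : mterm) : option nat := if t is Nd (e, _) _ _ then e else None.

Definition set_mark (e : option nat) (t : mterm) : mterm :=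
  if t is Nd (_, g) x y then Nd (e, g) x y else t.

Definition is_node (t : mterm) := if t is Nd _ _ _ then true else false.

Definition reducible g (t : mterm) :=
  if t is Nd (None, a) _ _ then rassoc a g else false.

(** [u] slides down the right spine of [t], past each unmarked node [a] with [rassoc a g]. A marked
    node stops the slide, since beyond a cut edge there is another vertex. *)
Fixpoint mul (g : generator) (t u : mterm) : mterm :=
  if t is Nd (None, a) x y then
    if rassoc a g then Nd (None, a) x (mul g y u) else Nd (None, g) t u
  else Nd (None, g) t u.

Fixpoint map_marks (f : nat -> option nat) (t : mterm) : mterm :=
  match t with
  | Lf l => Lf _ l
  | Nd (e, g) x y => Nd (obind f e, g) (map_marks f x) (map_marks f y)
  end.

Fixpoint nf (t : mterm) : mterm :=
  match t with
  | Lf l => Lf _ l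
  | Nd (e, g) x y => set_mark e (mul g (nf x) (nf y))
  end.

Definition recut f t := nf (map_marks f t).

Fixpoint is_nf (t : mterm) : bool :=
  if t is Nd (_, g) x y then [&& ~~ reducible g x, is_nf x & is_nf y] else true.

Fixpoint marks (t : mterm) : seq nat :=
  if t is Nd (e, _) x y then seq_of_opt e ++ marks x ++ marks y else [::].

(** Each node counts the leaves on its left, so rotating [(x a y) b z] into [x a (y b z)] lowers the
    sum by the number of leaves of [x]. *)
Fixpoint rank (t : mterm) : nat :=
  if t is Nd _ x y then (rank x + rank y + size (labels x))%N else 0.

(** * Normalization, marks and rank *)

Lemma mulE g t u : ~~ reducible g t -> mul g t u = Nd (None, g) t u.
Proof. by case: t => //= -[[e|] a] x y //= /negPf ->. Qed.

(** This is confluence, and also the reason why the relations hold between normal forms: if [a]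
    slides past a node [c] of [x], then so does [b], by transitivity of [rassoc]. *)
Lemma mulA a b x y z :
  rassoc a b -> mul b (mul a x y) z = mul a x (mul b y z).
Proof.
move=> ab; elim: x => [l|[[e|] c] x1 _ x2 IH] /=; rewrite ?ab //.
case: ifP => ca /=; last by rewrite ab.
by rewrite (rassoc_trans ca ab) IH.
Qed.

Lemma is_node_mul g t u : is_node (mul g t u).
Proof. by case: t => //= -[[e|] a] x y //; case: ifP. Qed.

Lemma mark_mul g t u : mark (mul g t u) = None.
Proof. by case: t => //= -[[e|] a] x y //; case: ifP. Qed.

Lemma is_node_set_mark e t : is_node (set_mark e t) = is_node t.
Proof. by case: t => //= -[]. Qed.

Lemma set_mark_set_mark e e' t : set_mark e (set_mark e' t) = set_mark e t.
Proof. by case: t => //= -[]. Qed.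

Lemma set_mark_mark t : set_mark (mark t) t = t.
Proof. by case: t => //= -[]. Qed.

Lemma mark_set_mark e t : is_node t -> mark (set_mark e t) = e.
Proof. by case: t => //= -[]. Qed.

(** A rotation made by [mul] concerns an unmarked edge, which stays unmarked, so [mulA] absorbs it
    after the recut. Being a morphism for [mul] is what lets [recut f] pass through the evaluation
    of operations. *)
Lemma recut_mul f g t u : recut f (mul g t u) = mul g (recut f t) (recut f u).
Proof.
have E c t' u' : set_mark None (mul c t' u') = mul c t' u'.
  by rewrite -{1}(mark_mul c t' u') set_mark_mark.
rewrite /recut; elim: t => [l|[[e|] a] x _ y IH] //=.
case: ifP => ag /=; last by rewrite !E.
by rewrite !E IH mulA.
Qed.

Lemma recut_set_mark f e t :
  is_node t -> mark t = None ->
  recut f (set_mark e t) = set_mark (obind f e) (recut f t).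
Proof.
by case: t => //= -[e' a] x y _ /= ->; rewrite /recut /= set_mark_set_mark.
Qed.

Lemma map_marks_comp f f' t : map_marks f (map_marks f' t) = map_marks (obind f \o f') t.
Proof.
by elim: t => [//|[e g] x IHx y IHy] /=; rewrite IHx IHy; case: e.
Qed.

Lemma map_marks_Some t : map_marks Some t = t.
Proof. by elim: t => //= -[[e|] g] x -> y ->. Qed.

Lemma eq_in_map_marks f f' t : {in marks t, f =1 f'} -> map_marks f t = map_marks f' t.
Proof.
elim: t => //= -[e g] x IHx y IHy H; congr (Nd (_, _) _ _).
- by case: e H => //= e H; apply: H; rewrite inE eqxx.
- by apply: IHx => z Hz; apply: H; rewrite !mem_cat Hz orbT.
- by apply: IHy => z Hz; apply: H; rewrite !mem_cat Hz !orbT.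
Qed.

(** Normalizing halfway has no effect; hence two edges can be contracted in either order. *)
Lemma recut_comp f f' t : recut f (recut f' t) = recut (obind f \o f') t.
Proof.
elim: t => [|[e g] x IHx y IHy] //; rewrite {2}/recut /= recut_set_mark.
- by rewrite recut_mul [recut f (nf _)]IHx [recut f (nf _)]IHy; case: e.
- exact: is_node_mul.
- exact: mark_mul.
Qed.

Lemma recut_map_marks f f' t : recut f (map_marks f' t) = recut (obind f \o f') t.
Proof. by rewrite /recut map_marks_comp. Qed.

Lemma map_marks_set_mark f e t :
  map_marks (Some \o f) (set_mark e t) = set_mark (omap f e) (map_marks (Some \o f) t).
Proof. by case: t => //= -[e' g] x y; case: e. Qed.

Lemma map_marks_mul f g t u :
  map_marks (Some \o f) (mul g t u)
  = mul g (map_marks (Some \o f) t) (map_marks (Some \o f) u).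
Proof.
elim: t => [l|[[e|] a] x _ y IH] //=; case: ifP => //= _; by rewrite IH.
Qed.

Lemma map_marks_nf f t : map_marks (Some \o f) (nf t) = nf (map_marks (Some \o f) t).
Proof.
elim: t => //= -[e g] x IHx y IHy; rewrite map_marks_set_mark map_marks_mul IHx IHy.
by case: e.
Qed.

Lemma nf_id t : is_nf t -> nf t = t.
Proof.
by elim: t => //= -[e g] x IHx y IHy /and3P[r /IHx -> /IHy ->]; rewrite mulE.
Qed.

Lemma is_nf_set_mark e t : is_nf (set_mark e t) = is_nf t.
Proof. by case: t => //= -[]. Qed.

Lemma is_nf_mul g t u : is_nf t -> is_nf u -> is_nf (mul g t u).
Proof.
move=> + nu; elim: t => [l|[[e|] a] x _ y IH] //=; first by rewrite nu andbT.
case/and3P=> r nx ny; case: ifP => ag /=; last by rewrite ag r nx ny nu.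
by rewrite r nx IH.
Qed.

Lemma is_nf_nf t : is_nf (nf t).
Proof. by elim: t => //= -[e g] x IHx y IHy; rewrite is_nf_set_mark is_nf_mul. Qed.

Lemma labels_set_mark e t : labels (set_mark e t) = labels t.
Proof. by case: t => //= -[]. Qed.

Lemma labels_mul g t u : labels (mul g t u) = labels t ++ labels u.
Proof.
elim: t => [l|[[e|] a] x _ y IH] //=; case: ifP => //= _; by rewrite IH catA.
Qed.

Lemma labels_nf t : labels (nf t) = labels t.
Proof. by elim: t => //= -[e g] x IHx y IHy; rewrite labels_set_mark labels_mul IHx IHy. Qed.

Lemma labels_map_marks f t : labels (map_marks f t) = labels t.
Proof. by elim: t => //= -[e g] x /= -> y ->. Qed.

Lemma labels_recut f t : labels (recut f t) = labels t.
Proof. by rewrite labels_nf labels_map_marks. Qed.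

Lemma marks_mul g t u : marks (mul g t u) = marks t ++ marks u.
Proof.
elim: t => [l|[[e|] a] x _ y IH] //=; case: ifP => //= _; by rewrite IH catA.
Qed.

Lemma marks_set_mark e t : is_node t -> mark t = None ->
  marks (set_mark e t) = seq_of_opt e ++ marks t.
Proof. by case: t => //= -[e' g] x y _ /= ->. Qed.

Lemma marks_nf t : marks (nf t) = marks t.
Proof.
elim: t => //= -[e g] x IHx y IHy.
by rewrite marks_set_mark ?is_node_mul ?mark_mul // marks_mul IHx IHy.
Qed.

Lemma marks_map_marks f t : marks (map_marks f t) = pmap f (marks t).
Proof.
elim: t => //= -[e g] x /= -> y ->; rewrite -pmap_cat.
by case: e => //= e; case: (f e).
Qed.

Lemma marks_recut f t : marks (recut f t) = pmap f (marks t).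
Proof. by rewrite marks_nf marks_map_marks. Qed.

Lemma is_node_nf t : is_node (nf t) = is_node t.
Proof. by case: t => //= -[e g] x y; rewrite is_node_set_mark is_node_mul. Qed.

Lemma is_node_map_marks f t : is_node (map_marks f t) = is_node t.
Proof. by case: t => //= -[e g] x y. Qed.

Lemma mark_nf t : mark (nf t) = mark t.
Proof. by case: t => //= -[e g] x y; rewrite mark_set_mark ?is_node_mul. Qed.

Lemma mark_map_marks f t : mark (map_marks f t) = obind f (mark t).
Proof. by case: t => //= -[e g] x y. Qed.

Lemma size_labels_gt0 (G : Type) (t : term G) : (0 < size (labels t))%N.
Proof. by elim: t => //= a x Hx y Hy; rewrite size_cat addn_gt0 Hx. Qed.

Lemma rank_set_mark e t : rank (set_mark e t) = rank t.
Proof. by case: t => //= -[]. Qed.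

Lemma rank_map_marks f t : rank (map_marks f t) = rank t.
Proof. by elim: t => //= -[e g] x /= -> y ->; rewrite labels_map_marks. Qed.

Lemma rank_mul g t u :
  (rank (mul g t u) <= rank t + rank u + size (labels t))%N.
Proof.
elim: t => [l|[[e|] a] x _ y IH] //=.
by case: ifP => _ //=; rewrite size_cat; lia.
Qed.

Lemma rank_mul_lt g t u : reducible g t ->
  (rank (mul g t u) < rank t + rank u + size (labels t))%N.
Proof.
case: t => //= -[[e|] a] x y //= ->; rewrite /= size_cat.
by have := rank_mul g y u; have := size_labels_gt0 x; lia.
Qed.

Lemma rank_nf t : (rank (nf t) <= rank t)%N.
Proof.
elim: t => //= -[e g] x IHx y IHy; rewrite rank_set_mark.
by have := rank_mul g (nf x) (nf y); rewrite labels_nf; lia.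
Qed.

(** The equality case separates the faces that only unmark an edge from those that belong to lower
    rank. *)
Lemma rank_nf_leif t : (rank (nf t) <= rank t ?= iff is_nf t)%N.
Proof.
split; first exact: rank_nf.
apply/idP/idP => [|/nf_id -> //].
elim: t => //= -[e g] x IHx y IHy; rewrite rank_set_mark => /eqP E.
have := rank_mul g (nf x) (nf y); have := rank_nf x; have := rank_nf y.
rewrite labels_nf => ly lx lm.
have nx : is_nf x by apply: IHx; apply/eqP; lia.
have ny : is_nf y by apply: IHy; apply/eqP; lia.
rewrite nx ny !andbT; apply/negP => r.
by have := rank_mul_lt (nf y) r; rewrite -{1}(nf_id nx) E; lia.
Qed.

Lemma rank_leq t : (rank t <= size (labels t) * size (labels t))%N.
Proof.
by elim: t => //= -[e g] x IHx y IHy; rewrite size_cat; have := size_labels_gt0 y; nia.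
Qed.

(** * The first nonreducible edge of a term *)

Definition left_stable g (x : mterm) :=
  if x is Nd (_, a) _ _ then ~~ rassoc a g else false.

(** The mark of the first nonreducible edge, in the order: left edge of the root, left subtree,
    right edge of the root. Only left edges are ever rotated, so every right edge is nonreducible
    and the search need not enter [y]. No test reads a mark. *)
Fixpoint pivot (t : mterm) : option (option nat) :=
  if t is Nd (_, g) x y then
    if left_stable g x then Some (mark x)
    else if pivot x is Some r then Some r
    else if is_node y then Some (mark y) else None
  else None.

Fixpoint set_pivot (r : option nat) (t : mterm) : mterm :=
  if t is Nd e x y then
    if left_stable e.2 x then Nd e (set_mark r x) y
    else if pivot x then Nd e (set_pivot r x) y
    else Nd e x (set_mark r y)
  else t.

Lemma left_stable_set_mark g e x : left_stable g (set_mark e x) = left_stable g x.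
Proof. by case: x => //= -[]. Qed.

Lemma left_stable_set_pivot g e x : left_stable g (set_pivot e x) = left_stable g x.
Proof. by case: x => //= -[e' a] x y /=; do 2 case: ifP => //. Qed.

Lemma left_stable_map_marks g f x : left_stable g (map_marks f x) = left_stable g x.
Proof. by case: x => //= -[]. Qed.

Lemma pivot_set r t : pivot t -> pivot (set_pivot r t) = Some r.
Proof.
elim: t => //= -[e g] x IHx y IHy /=; case: ifP => lx /=.
  by rewrite left_stable_set_mark lx; case: x lx {IHx} => //= -[].
case px: (pivot x) => [r'|] /=.
  by rewrite left_stable_set_pivot lx IHx // px.
by rewrite lx px is_node_set_mark; case: ifP => // ny; rewrite mark_set_mark.
Qed.

Lemma set_pivot_id r t : pivot t = Some r -> set_pivot r t = t.
Proof.
elim: t => //= -[e g] x IHx y IHy /=; case: ifP => lx.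
  by case=> <-; rewrite set_mark_mark.
case px: (pivot x) => [r'|] /=; first by case=> rr; rewrite IHx // px rr.
by case: ifP => // ny [<-]; rewrite set_mark_mark.
Qed.

Lemma set_pivot_set r r' t : set_pivot r (set_pivot r' t) = set_pivot r t.
Proof.
elim: t => //= -[e g] x IHx y IHy /=; case: ifP => lx.
  by rewrite /= left_stable_set_mark lx set_mark_set_mark.
case px: (pivot x) => [s|] /=; last by rewrite lx px set_mark_set_mark.
by rewrite left_stable_set_pivot lx pivot_set ?px //= IHx.
Qed.

Lemma pivot_map_marks f t : pivot (map_marks f t) = omap (obind f) (pivot t).
Proof.
elim: t => //= -[e g] x IHx y IHy /=.
rewrite left_stable_map_marks !mark_map_marks is_node_map_marks IHx.
case: ifP => // _; case: (pivot x) => //=; by case: ifP.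
Qed.

Lemma map_marks_set_pivot f r t :
  map_marks f (set_pivot r t) = set_pivot (obind f r) (map_marks f t).
Proof.
have ms e x : map_marks f (set_mark e x) = set_mark (obind f e) (map_marks f x).
  by case: x => //= -[].
elim: t => //= -[e g] x IHx y IHy /=.
rewrite left_stable_map_marks pivot_map_marks.
case: ifP => /= _; first by rewrite ms.
by case: (pivot x) => [s|] /=; rewrite ?IHx ?ms.
Qed.

Lemma reducible_set_pivot g r t : reducible g (set_pivot r t) = reducible g t.
Proof. by case: t => //= -[e' a] x y /=; case: ifP => // _; case: ifP. Qed.

Lemma mark_set_pivot r t : mark (set_pivot r t) = mark t.
Proof. by case: t => //= -[e' a] x y /=; case: ifP => // _; case: ifP. Qed.

Lemma is_node_set_pivot r t : is_node (set_pivot r t) = is_node t.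
Proof. by case: t => //= -[e' a] x y /=; case: ifP => // _; case: ifP. Qed.

Lemma labels_set_pivot r t : labels (set_pivot r t) = labels t.
Proof.
elim: t => //= -[e g] x IHx y IHy /=.
by case: ifP => _ /=; [|case: ifP => _ /=]; rewrite ?labels_set_mark ?IHx.
Qed.

Lemma rank_set_pivot r t : rank (set_pivot r t) = rank t.
Proof.
elim: t => //= -[e g] x IHx y IHy /=.
by case: ifP => _ /=; [|case: ifP => _ /=];
   rewrite ?rank_set_mark ?labels_set_mark ?labels_set_pivot ?IHx.
Qed.

Lemma is_nf_set_pivot r t : is_nf t -> is_nf (set_pivot r t).
Proof.
elim: t => //= -[e g] x IHx y IHy /= /and3P[rx nx ny].
case: ifP => lx /=.
  rewrite is_nf_set_mark nx ny !andbT.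
  by case: x lx {IHx rx nx} => //= -[e' a] x1 x2 /= lx; case: {IHy} r.
case: ifP => px /=; first by rewrite reducible_set_pivot rx ny IHx.
by rewrite rx nx is_nf_set_mark.
Qed.

Lemma marks_set_pivot e t : pivot t ->
  perm_eq (marks (set_pivot (Some e) t)) (e :: marks (set_pivot None t)).
Proof.
have ms x : is_node x -> marks (set_mark (Some e) x) = e :: marks (set_mark None x).
  by case: x => //= -[].
elim: t => //= -[e' g] x IHx y IHy /=; case: ifP => lx /= => [_|].
  rewrite ms; last by case: x lx {IHx}.
  by rewrite (perm_catCA (seq_of_opt e') [:: e]).
case px: (pivot x) => [s|] /= => [_|].
  rewrite perm_sym (perm_catCA [:: e] (seq_of_opt e')) perm_cat2l perm_sym.
  by rewrite catA perm_cat2r IHx // px.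
case ny: (is_node y) => // _; rewrite ms //.
rewrite perm_sym (perm_catCA [:: e] (seq_of_opt e')) perm_cat2l.
by rewrite (perm_catCA [:: e] (marks x)).
Qed.

(* A normal term all of whose edges are reducible is a left comb with every
   edge marked. *)
Lemma pivot_None t : is_nf t -> ~~ pivot t ->
  (size (marks t) + (is_node t && ~~ mark t) + 1 = size (labels t))%N.
Proof.
elim: t => //= -[e g] x IHx y _ /= /and3P[rx nx ny].
case: ifP => // lx; case px: (pivot x) => [s|] //=; case: ifP => // nny _.
rewrite !size_cat -IHx ?px //.
case: y nny {ny} => //= l _.
have -> : (is_node x && ~~ mark x)%N = false.
  by case: x lx rx {IHx nx px} => //= -[[e'|] a] x1 x2 //= /negPn ->.
by case: e => [e|] /=; lia.
Qed.

(** * Faces of marked terms and renumberings of their marks *)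

(** These terms index the coordinates of a cochain of arity [n] and degree [j], up to the sign of a
    renumbering. *)
Definition valid n j (t : mterm) :=
  [&& is_node t, mark t == None, is_nf t, perm_eq (labels t) (iota 0 n)
    & perm_eq (marks t) (iota 0 j)].

Definition omit i e := if e == i then None else Some (unbump i e).

Definition face i t := recut (omit i) t.

Lemma omit_id i : omit i i = None.
Proof. by rewrite /omit eqxx. Qed.

Lemma omit_bump i e : omit i (bump i e) = Some e.
Proof. by rewrite /omit eq_sym (negPf (neq_bump _ _)) bumpK. Qed.

Lemma iota_bump i j : (i < j.+1)%N ->
  perm_eq (iota 0 j.+1) (i :: [seq bump i e | e <- iota 0 j]).
Proof.
move=> ij; apply: uniq_perm; first exact: iota_uniq.
  rewrite /= map_inj_uniq ?iota_uniq ?andbT; last exact: can_inj (bumpK i).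
  by apply/mapP => -[e _] /eqP; rewrite (negPf (neq_bump _ _)).
move=> e; rewrite mem_iota inE; apply/idP/orP => [ej|[/eqP -> //|/mapP[k]]].
  case: (eqVneq e i) => [|ei]; [by left | right].
  apply/mapP; exists (unbump i e); last by rewrite unbumpK.
  by rewrite mem_iota /unbump; lia.
by rewrite mem_iota /bump => ? ->; lia.
Qed.

Lemma pmap_omit i s j : perm_eq s (iota 0 j.+1) -> (i < j.+1)%N ->
  perm_eq (pmap (omit i) s) (iota 0 j).
Proof.
move=> H ij; apply: perm_trans (perm_pmap (omit i) (perm_trans H (iota_bump ij))) _.
by rewrite /= omit_id /= (map_pK (@omit_bump i)).
Qed.

Lemma eq_recut f f' t : {in marks t, f =1 f'} -> recut f t = recut f' t.
Proof. by move=> H; rewrite /recut (eq_in_map_marks H). Qed.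

Lemma valid_face n j i t :
  valid n j.+1 t -> (i < j.+1)%N -> valid n j (face i t).
Proof.
case/and5P=> nt /eqP mt _ lt st ij; apply/and5P; split.
- by rewrite is_node_nf is_node_map_marks.
- by rewrite mark_nf mark_map_marks mt.
- exact: is_nf_nf.
- by rewrite labels_recut.
- by rewrite marks_recut; apply: pmap_omit.
Qed.

(** A renumbering [g] of the edges induces a renumbering [h] of those that remain once edge [i] is
    contracted; [lift_perm] relates the two signs. *)
Lemma lift_permP j (g : 'S_j.+1) (i : 'I_j.+1) :
  exists h : 'S_j, g = lift_perm i (g i) h.
Proof.
(* Delete [i] from the source and [s i] from the target; the default [k] of [odflt] is never
   reached. *)
pose r i (s : 'S_j.+1) k := odflt k (unlift (s i) (s (lift i k))).
have rK a (s : 'S_j.+1) k : lift (s a) (r a s k) = s (lift a k).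
  rewrite /r; have := neq_lift a k.
  by rewrite -(can_eq (permK s)) => /unlift_some[] ? ? ->.
have r_inj : injective (r i g).
  by apply: can_inj (r (g i) g^-1%g) _ => k; rewrite {1}/r rK !permK liftK.
exists (perm r_inj); apply/permP => k.
case: (unliftP i k) => [k'|] ->; rewrite ?lift_perm_id //.
by rewrite lift_perm_lift permE rK.
Qed.
Lemma is_recut_Some f t : is_nf (map_marks (Some \o f) t) = is_nf t.
Proof.
elim: t => //= -[e g] x <- y <-; congr (~~ _ && _).
by case: x => //= -[[]].
Qed.

Lemma face_is_nf i t : is_nf (map_marks (omit i) t) -> face i t = map_marks (omit i) t.
Proof. exact: nf_id. Qed.

Lemma rank_face i t : (rank (face i t) <= rank t)%N.
Proof. by have := rank_nf_leif (map_marks (omit i) t); rewrite rank_map_marks => -[]. Qed.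

Lemma rank_face_lt i t : ~~ is_nf (map_marks (omit i) t) -> (rank (face i t) < rank t)%N.
Proof.
move=> /negPf nn; have := rank_nf_leif (map_marks (omit i) t).
by rewrite rank_map_marks ltn_neqAle => -[-> ->]; rewrite nn.
Qed.

Lemma omitC i k e : i != k ->
  obind (omit (unbump i k)) (omit i e) = obind (omit (unbump k i)) (omit k e).
Proof.
move=> ik; rewrite /omit /unbump.
case: (eqVneq e i) => ei; case: (eqVneq e k) => ek //=;
  do ?case: eqP => //=; try lia.
by move=> ? ?; congr Some; lia.
Qed.

(** In characteristic 2 antisymmetry does not make the diagonal vanish, whence the separate
    hypothesis. [F] is [T] minus its transpose, where [T] is the part of [F] above the diagonal. *)
Lemma sum_antisym (V : zmodType) n (F : 'I_n -> 'I_n -> V) :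
  (forall i, F i i = 0) -> (forall i k, F k i = - F i k) ->
  \sum_i \sum_k F i k = 0.
Proof.
move=> F0 FN; pose T (i k : 'I_n) := if (i < k)%N then F i k else 0.
have FT i k : F i k = T i k - T k i.
  by rewrite /T; case: ltngtP => [_|_|/val_inj ->]; rewrite ?subr0 ?sub0r ?oppr0 //.
under eq_bigr => i _ do under eq_bigr => k _ do rewrite FT.
under eq_bigr => i _ do rewrite sumrB.
by rewrite sumrB [X in _ - X]exchange_big subrr.
Qed.

(** * The differential on marked terms and its contracting homotopy *)

Section Cochains.
Variable K : fieldType.
Implicit Types (phi psi : mterm -> K).

Definition delta j phi t : K := \sum_(i < j) (-1) ^+ i * phi (face i t).

Lemma delta_delta j phi t : delta j.+1 (delta j phi) t = 0.
Proof.
(* [i] and [k] both refer to the numbering of [t]: [unbump i k] is the number of edge [k] once [i]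
   is gone. *)
pose F (i k : 'I_j.+1) := if i == k then 0 else
  (-1) ^+ (i + unbump i k) * phi (face (unbump i k) (face i t)).
rewrite -[RHS](@sum_antisym _ _ F).
- apply: eq_bigr => i _; rewrite /delta (bigD1_ord i) //= /F eqxx add0r mulr_sumr.
  apply: eq_bigr => k _; rewrite (negPf (neq_lift _ _)) /= bumpK.
  by rewrite exprD mulrA.
- by move=> i; rewrite /F eqxx.
move=> i k; rewrite /F eq_sym; case: eqVneq => [_|ik]; first by rewrite oppr0.
have -> : face (unbump k i) (face k t) = face (unbump i k) (face i t).
  rewrite /face !recut_comp; apply: eq_recut => e _ /=.
  by rewrite omitC // eq_sym.
rewrite -mulNr -[(-1) ^+ (k + _)]signr_odd -[(-1) ^+ (i + _)]signr_odd.
(* Only the larger of [i] and [k] drops by one when it is contracted second, so the two orders have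
   opposite signs. *)
have -> : odd (k + unbump k i) = ~~ odd (i + unbump i k).
  by move: ik; rewrite -val_eqE /= /unbump; lia.
by rewrite signrN.
Qed.

Lemma deltaB j phi psi t :
  delta j (fun u => phi u - psi u) t = delta j phi t - delta j psi t.
Proof. by rewrite /delta -sumrB; apply: eq_bigr => i _; rewrite mulrBr. Qed.

Lemma deltaD j phi psi t :
  delta j (fun u => phi u + psi u) t = delta j phi t + delta j psi t.
Proof. by rewrite /delta -big_split; apply: eq_bigr => i _; rewrite mulrDr. Qed.

Definition alternating n j phi := forall (g : 'S_j) t,
  valid n j t -> phi (map_marks (Some \o permn g) t) = (-1) ^+ g * phi t.

Lemma valid_marks n j t e : valid n j t -> e \in marks t -> (e < j)%N.
Proof. by case/and5P => _ _ _ _ /perm_mem ->; rewrite mem_iota. Qed.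

Lemma face_permn n j (g : 'S_j.+1) (h : 'S_j) (i : 'I_j.+1) t :
  valid n j.+1 t -> g = lift_perm i (g i) h ->
  face (g i) (map_marks (Some \o permn g) t) = map_marks (Some \o permn h) (face i t).
Proof.
move=> vt gE; rewrite {1}/face recut_map_marks /face {2}/recut map_marks_nf map_marks_comp.
apply: eq_recut => e /(valid_marks vt) ej /=.
rewrite -[e]/(val (Ordinal ej)) permnE; case: (unliftP i (Ordinal ej)) => [k|] ->.
  by rewrite {2}gE lift_perm_lift /= !omit_bump /= permnE.
by rewrite /= !omit_id.
Qed.

Lemma delta_alternating n j phi :
  alternating n j phi -> alternating n j.+1 (delta j.+1 phi).
Proof.
move=> altp g t vt; rewrite /delta (reindex_inj (@perm_inj _ g)) /= mulr_sumr.
apply: eq_bigr => i _; have [h gE] := lift_permP g i.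
rewrite (face_permn vt gE) altp; last exact: valid_face.
rewrite !mulrA; congr (_ * _); rewrite {2}gE odd_lift_perm.
rewrite !signr_addb !signr_odd.
by rewrite [RHS]mulrC !mulrA -expr2 sqrr_sign mul1r.
Qed.

(** The new mark comes first in the numbering, so that face 0 undoes [push] on a normal term with
    unmarked pivot. *)
Definition push t := set_pivot (Some 0%N) (map_marks (Some \o succn) t).

Lemma valid_push n j t : valid n j t -> pivot t = Some None ->
  valid n j.+1 (push t).
Proof.
case/and5P=> nt /eqP mt rt lt st pt; apply/and5P; split.
- by rewrite is_node_set_pivot is_node_map_marks.
- by rewrite mark_set_pivot mark_map_marks mt.
- by rewrite is_nf_set_pivot // is_recut_Some.
- by rewrite labels_set_pivot labels_map_marks.
have ps : pivot (map_marks (Some \o succn) t) = Some None by rewrite pivot_map_marks pt.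
apply: perm_trans (marks_set_pivot 0%N _) _; first by rewrite ps.
rewrite (set_pivot_id ps) /= perm_cons marks_map_marks.
rewrite (_ : pmap _ _ = map succn (marks t)); last first.
  by elim: (marks t) => //= e s ->.
by rewrite -[1%N]addn0 iotaDl; apply: perm_map.
Qed.

Lemma push_permn n j (g : 'S_j) t : valid n j t ->
  push (map_marks (Some \o permn g) t)
  = map_marks (Some \o permn (lift_perm ord0 ord0 g)) (push t).
Proof.
move=> vt; rewrite /push map_marks_set_pivot /= !map_marks_comp.
rewrite -[X in permn _ X]/(val (ord0 : 'I_j.+1)) permnE lift_perm_id.
congr set_pivot; apply: eq_in_map_marks => e /(valid_marks vt) ej /=.
rewrite -[e]/(val (Ordinal ej)) permnE.
by rewrite -[e.+1]/(val (lift ord0 (Ordinal ej))) permnE lift_perm_lift.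
Qed.

(* Only the cochains vanishing in rank < r will be contracted, so that the terms of
   lower rank in the differential can be ignored. *)
Definition homotopy r phi t : K :=
  if (rank t == r) && (pivot t == Some None) then phi (push t) else 0.

Lemma homotopy_alternating n j r phi :
  alternating n j.+1 phi -> alternating n j (homotopy r phi).
Proof.
move=> altp g t vt; rewrite /homotopy rank_map_marks pivot_map_marks.
have -> : (omap (obind (Some \o permn g)) (pivot t) == Some None)
  = (pivot t == Some None) by case: (pivot t) => [[]|].
case: ifP => [/andP[_ /eqP pt]|_]; last by rewrite mulr0.
by rewrite (push_permn g vt) altp ?odd_lift_perm //; apply: valid_push.
Qed.

Section Step.
Variables (n j r : nat) (phi : mterm -> K).
Hypothesis jn : (j.+2 < n)%N.
Hypothesis alt_phi : alternating n j phi.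
Hypothesis cocycle_phi : forall t, valid n j.+1 t -> delta j.+1 phi t = 0.
Hypothesis phi0 : forall t, valid n j t -> (rank t < r)%N -> phi t = 0.

(** This is the cocycle condition at [push t]. Its face 0 is [t]; modulo lower rank, its face [i.+1]
    is [push] of face [i] of [t], and the shift of the index supplies the sign. *)
Lemma homotopy_unmarked t : valid n j t -> rank t = r -> pivot t = Some None ->
  phi t = delta j (homotopy r phi) t.
Proof.
move=> vt rt pt; have vp := valid_push vt pt.
have [_ _ nt _ _] := and5P vt.
have := cocycle_phi vp; rewrite /delta big_ord_recl mul1r.
have -> : face (ord0 : 'I_j.+1) (push t) = t.
  rewrite /face /recut /push map_marks_set_pivot /= map_marks_comp.
  have H : {in marks t, obind (omit 0%N) \o (Some \o succn) =1 Some}.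
    by move=> e _; rewrite /= /omit /= /unbump subn1.
  by rewrite (eq_in_map_marks H) map_marks_Some omit_id set_pivot_id // nf_id.
move=> /eqP; rewrite addr_eq0 => /eqP ->; rewrite -sumrN; apply: eq_bigr => i _.
rewrite /= /bump add1n exprS mulN1r mulNr opprK; congr (_ * _).
have faceE : face i.+1 (push t)
  = nf (set_pivot (Some 0%N) (map_marks (Some \o succn) (map_marks (omit i) t))).
  rewrite /face /recut /push map_marks_set_pivot /= !map_marks_comp.
  congr (nf (set_pivot _ _)); apply: eq_in_map_marks => e _ /=.
  rewrite /omit eqSS; case: eqP => //= _; congr Some.
  by rewrite /unbump ltnS; lia.
have pm : pivot (map_marks (Some \o succn) (map_marks (omit i) t)) = Some None.
  by rewrite !pivot_map_marks pt.
(* If face [i] needs no normalization, it commutes with [push]. Otherwise both sides vanish: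
   [homotopy] by its rank test, [phi] because it is zero below rank [r]. *)
have [nu|nu] := boolP (is_nf (map_marks (omit i) t)).
  rewrite /homotopy (face_is_nf nu) rank_map_marks rt pivot_map_marks pt !eqxx /=.
  by rewrite faceE nf_id // is_nf_set_pivot // is_recut_Some.
rewrite /homotopy (ltn_eqF (_ : rank (face i t) < r)%N) /=; last first.
  by rewrite -rt rank_face_lt.
apply: phi0; first by apply: (valid_face vp); rewrite ltnS.
rewrite faceE; set v := set_pivot _ _.
have <- : rank v = r by rewrite rank_set_pivot !rank_map_marks.
have [le eq] := rank_nf_leif v.
(* If [v] were normal, unmarking its pivot would leave it normal, against [nu]. *)
rewrite ltn_neqAle le eq andbT; apply: contra nu => /(is_nf_set_pivot None).
by rewrite set_pivot_set (set_pivot_id pm) is_recut_Some.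
Qed.

(** A face of rank [r] has an unmarked pivot only if it is the pivot that it opens, so a single term
    of the sum survives. *)
Lemma homotopy_marked t a :
  valid n j t -> rank t = r -> pivot t = Some (Some a) ->
  phi t = delta j (homotopy r phi) t.
Proof.
move=> vt rt pt; have [_ _ nt _ st] := and5P vt.
set t' := set_pivot None t.
have tE : t = set_pivot (Some a) t' by rewrite set_pivot_set set_pivot_id.
have := marks_set_pivot a (_ : pivot t); rewrite pt => /(_ isT).
rewrite (set_pivot_id pt) -/t' => mt.
have aj : (a < j)%N by apply: (valid_marks vt); rewrite (perm_mem mt) inE eqxx.
have : uniq (marks t) by rewrite (perm_uniq st) iota_uniq.
rewrite (perm_uniq mt) => /andP[at' _].
have marks_t' e : e \in marks t' -> (e < j)%N.
  by move=> et'; apply: (valid_marks vt); rewrite (perm_mem mt) inE et' orbT.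
rewrite /delta (bigD1 (Ordinal aj)) //= [X in _ + X]big1 ?addr0; last first.
  move=> i; rewrite -val_eqE /= eq_sym => ia.
  rewrite /homotopy; case: eqP => [rf|_]; last by rewrite mulr0.
  rewrite ifN ?mulr0 //=.
  have [nu|/rank_face_lt] := boolP (is_nf (map_marks (omit i) t)); last by rewrite rf rt ltnn.
  by rewrite face_is_nf // pivot_map_marks pt /= /omit (negPf ia).
have omitE : map_marks (omit a) t' = map_marks (Some \o unbump a) t'.
  apply: eq_in_map_marks => e et'; rewrite /omit /= ifN //.
  by apply: contraNneq at' => <-.
have uE : map_marks (omit a) t = set_pivot None (map_marks (Some \o unbump a) t').
  by rewrite {1}tE map_marks_set_pivot /= omit_id omitE.
have nu : is_nf (map_marks (omit a) t).
  by rewrite uE is_nf_set_pivot // is_recut_Some is_nf_set_pivot.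
rewrite /homotopy face_is_nf // rank_map_marks rt pivot_map_marks pt /= omit_id !eqxx /=.
case: j aj alt_phi vt marks_t' => // j' aj altp vt marks_t'.
(* Opening the pivot and marking it again moves its number from [a] to 0 and keeps the order of the
   others. This cycle [c] has sign [(-1) ^+ a], which cancels the sign of face [a]. *)
pose c := lift_perm (Ordinal aj) ord0 (1%g : 'S_j').
have -> : push (map_marks (omit a) t) = map_marks (Some \o permn c) t.
  rewrite uE /push map_marks_set_pivot set_pivot_set map_marks_comp.
  rewrite [in RHS]tE map_marks_set_pivot /= -[a in permn c a]/(val (Ordinal aj)) permnE.
  rewrite lift_perm_id; congr set_pivot; apply: eq_in_map_marks => e et' /=.
  have ej := marks_t' _ et'; rewrite -[e in RHS]/(val (Ordinal ej)) permnE.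
  case: (unliftP (Ordinal aj) (Ordinal ej)) => [k|/(congr1 val)/= ea].
    move=> ek; have eE : e = bump a k := congr1 val ek.
    by rewrite ek lift_perm_lift perm1 eE bumpK.
  by rewrite ea (negPf at') in et'.
rewrite altp // odd_lift_perm odd_perm1 /= !addbF signr_odd mulrA -expr2.
by rewrite sqrr_sign mul1r.
Qed.

Lemma homotopyP t : valid n j t -> (rank t <= r)%N ->
  phi t = delta j (homotopy r phi) t.
Proof.
move=> vt; rewrite leq_eqVlt => /predU1P[rt|rt]; last first.
  rewrite phi0 // /delta big1 // => i _; rewrite /homotopy ltn_eqF ?mulr0 //.
  exact: leq_ltn_trans (rank_face _ _) rt.
case pt: (pivot t) => [[a|]|]; first exact: homotopy_marked pt.
  exact: homotopy_unmarked.
(* Without a pivot, all edges are marked left edges and the term has [j + 2] leaves, against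
   [jn]. *)
have [nt /eqP mt rnt /perm_size lt /perm_size st] := and5P vt.
have := pivot_None rnt; rewrite pt nt mt => /(_ isT).
by rewrite lt st !size_iota /=; lia.
Qed.

End Step.

Lemma valid_rank n j t : valid n j t -> (rank t < (n * n).+1)%N.
Proof.
case/and5P => _ _ _ /perm_size lt _.
by have := rank_leq t; rewrite lt size_iota.
Qed.

(** [delta 0] is an empty sum, so [homotopyP] kills the values of [phi] one rank after the other. *)
Lemma cocycle0 n phi : (2 < n)%N -> alternating n 0 phi ->
  (forall t, valid n 1 t -> delta 1 phi t = 0) ->
  forall t, valid n 0 t -> phi t = 0.
Proof.
move=> n2 altp coc t vt.
suff H r u : valid n 0 u -> (rank u < r)%N -> phi u = 0.
  exact: H vt (valid_rank vt).
elim: r u => // r IH u vu ru.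
by rewrite (homotopyP (r := r) n2 altp coc IH vu) // /delta big_ord0.
Qed.

Lemma cocycle_coboundary n j phi : (j.+3 < n)%N -> alternating n j.+1 phi ->
  (forall t, valid n j.+2 t -> delta j.+2 phi t = 0) ->
  exists2 psi, alternating n j psi &
    forall t, valid n j.+1 t -> phi t = delta j.+1 psi t.
Proof.
move=> jn altp coc.
suff [psi alt_psi H] : exists2 psi, alternating n j psi & forall t,
    valid n j.+1 t -> (rank t < (n * n).+1)%N -> phi t = delta j.+1 psi t.
  by exists psi => // t vt; apply: H (valid_rank vt).
(* Induction on the rank bound [r]: the primitive [psi] found so far is corrected by the homotopy of
   the error [phi'], which vanishes below rank [r]. *)
elim: (n * n)%N.+1 => [|r [psi alt_psi IH]].
  by exists (fun=> 0) => [g t _|//]; rewrite mulr0.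
pose phi' t := phi t - delta j.+1 psi t.
have alt' : alternating n j.+1 phi'.
  move=> g t vt; rewrite /phi' altp // mulrBr; congr (_ - _).
  exact: (delta_alternating alt_psi).
have coc' t : valid n j.+2 t -> delta j.+2 phi' t = 0.
  by move=> vt; rewrite deltaB delta_delta coc // subr0.
have phi'0 t : valid n j.+1 t -> (rank t < r)%N -> phi' t = 0.
  by move=> vt rt; rewrite /phi' IH // subrr.
exists (fun t => psi t + homotopy r phi' t).
  move=> g t vt; rewrite mulrDr alt_psi //; congr (_ + _).
  exact: (homotopy_alternating r alt').
move=> t vt rt; rewrite deltaD -(homotopyP (n := n)) //.
by rewrite /phi' addrC subrK.
Qed.

End Cochains.

(** * Evaluation of decorated trees *)

Section Trees.
Variables (K : fieldType) (P : operad K).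
Implicit Types (T : tree P) (c : child (tree P)) (s : seq (child (tree P))).

(** The subtrees are nested in a list; they are reached by position because a decoration addresses
    its inputs by position. *)
Lemma tree_ind_nth (Pr : tree P -> Prop) :
  (forall k (p : P k) s,
     (forall i e u, nth (Leaf _ 0) s i = Edge e u -> Pr u) -> Pr (Vtx p s)) ->
  forall T, Pr T.
Proof.
move=> H; fix IH 1 => -[k p s]; apply: H.
elim: s => [|c s IHs] i e u; first by case: i {IH}.
case: i => [|i]; last exact: IHs.
by case: c => [l|e' u'] /=; [case: e {IH} | case=> _ <-; exact: IH].
Qed.

Definition cleaves c := match c with Leaf l => [:: l] | Edge e u => leaves u end.
Definition cedges c :=
  match c with Leaf _ => [::] | Edge e u => e :: edges u end.
Definition creduced c := if c is Edge _ u then reduced u else true.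

Lemma leavesE k (p : P k) s : leaves (Vtx p s) = flatten (map cleaves s).
Proof. by []. Qed.

Lemma edgesE k (p : P k) s : edges (Vtx p s) = flatten (map cedges s).
Proof. by []. Qed.

Lemma reducedE k (p : P k) s :
  reduced (Vtx p s) = [&& (1 < k)%N, size s == k & all creduced s].
Proof. by []. Qed.

Lemma map_nth_iota (A : Type) (f : child (tree P) -> A) s :
  [seq f (nth (Leaf _ 0) s i) | i <- iota 0 (size s)] = map f s.
Proof. by rewrite (map_comp f) [X in map f X]mkseq_nth. Qed.

Lemma mem_edges_nth e k (p : P k) s i : (i < size s)%N ->
  e \in cedges (nth (Leaf _ 0) s i) -> e \in edges (Vtx p s).
Proof.
rewrite edgesE; elim: s i => // c s IH [|i] /= si; rewrite mem_cat => H.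
  by rewrite H.
by rewrite (IH i) ?orbT.
Qed.

Lemma uniq_edges_nth e k (p : P k) s i j : uniq (edges (Vtx p s)) ->
  (i < size s)%N -> (j < size s)%N ->
  e \in cedges (nth (Leaf _ 0) s i) -> e \in cedges (nth (Leaf _ 0) s j) -> i = j.
Proof.
rewrite edgesE; elim: s i j => // c s IH i j /=; rewrite cat_uniq.
case/and3P=> _ /hasPn dis us.
case: i j => [|i] [|j] //= si sj ei ej; last by rewrite (IH i j).
  by have := dis e (mem_edges_nth p (i := j) sj ej); rewrite /= ei.
by have := dis e (mem_edges_nth p (i := i) si ei); rewrite /= ej.
Qed.

Lemma uniq_cedges k (p : P k) s i : uniq (edges (Vtx p s)) ->
  uniq (cedges (nth (Leaf _ 0) s i)).
Proof.
rewrite edgesE; elim: s i => [|c s IH] [|i] //=; rewrite cat_uniq.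
  by case/and3P.
by case/and3P => _ _ /IH.
Qed.

Lemma is_edgeP e c : is_edge e c -> exists u, c = Edge e u.
Proof. by case: c => //= e' u /eqP <-; exists u. Qed.

Definition contract_child e c :=
  match c with Leaf l => Leaf _ l | Edge e' u => Edge e' (contract e u) end.

(** In a reduced tree a vertex has as many children as its decoration has inputs, so the position of
    [e] is an input of [p] and the fallback branch of [contract] is not taken. *)
Lemma contract_has k (p : P k) s e : reduced (Vtx p s) ->
  has (is_edge e) s ->
  exists (i : 'I_k) m (q : P m) s',
    nth (Leaf _ 0) s i = Edge e (Vtx q s') /\
    contract e (Vtx p s) = Vtx (comp i p q) (take i s ++ s' ++ drop i.+1 s).
Proof.
rewrite reducedE => /and3P[_ /eqP sk _] hs.
have := hs; rewrite has_find sk => ik.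
have [[m q s'] nE] := is_edgeP (nth_find (Leaf _ 0) hs).
exists (Ordinal ik), m, q, s'; split=> //=.
by rewrite nE insubT.
Qed.

Lemma contract_hasN k (p : P k) s e : ~~ has (is_edge e) s ->
  contract e (Vtx p s) = Vtx p (map (contract_child e) s).
Proof. by move=> /hasNfind fs; rewrite /= fs nth_default. Qed.

End Trees.

Section Evaluation.
Variable K : fieldType.
Local Notation F := (free K generator).
Local Notation P := (P_ne K).
Local Notation functional := ((mterm -> K) -> K).
Implicit Types (L : functional) (rho : nat -> functional) (kappa : mterm -> K).

Definition linear_form L := forall a kappa1 kappa2,
  L (fun t => a * kappa1 t + kappa2 t) = a * L kappa1 + L kappa2.

Lemma linear_form0 L : linear_form L -> L (fun=> 0) = 0.
Proof.
move=> LL; have := LL (-1) (fun=> 0) (fun=> 0).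
have -> : (fun t : mterm => -1 * 0 + 0 : K) = fun=> 0.
  by apply: funext => t; rewrite mulr0 addr0.
by move=> ->; rewrite mulN1r addNr.
Qed.

Lemma linear_formZ L a kappa : linear_form L -> L (fun t => a * kappa t) = a * L kappa.
Proof.
move=> LL; rewrite -[RHS]addr0 -(linear_form0 LL) -LL.
by congr L; apply: funext => t; rewrite addr0.
Qed.

Lemma linear_form_sum L (J : Type) (r : seq J) (a : J -> K) (kappa : J -> mterm -> K) :
  linear_form L -> L (fun t => \sum_(j <- r) a j * kappa j t)
  = \sum_(j <- r) a j * L (kappa j).
Proof.
move=> LL; elim: r => [|j r IH].
  rewrite big_nil -[RHS](linear_form0 LL); congr L; apply: funext => t.
  by rewrite big_nil.
rewrite big_cons -IH -LL; congr L; apply: funext => t; by rewrite big_cons.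
Qed.

(* A formal linear combination of marked terms is represented by the linear form
   it induces on functions of marked terms, and a tree of vectors by the
   combination to which it expands.  The inputs are expanded in the order of the
   leaves of w, not in that of their labels, which makes the equivariance
   immediate. *)
Fixpoint eval_term (w : term generator) rho kappa : K :=
  match w with
  | Lf l => rho l kappa
  | Nd g t u => eval_term t rho (fun a => eval_term u rho (fun b => kappa (mul g a b)))
  end.

Lemma eval_term_bind w f rho :
  eval_term (bind w f) rho = eval_term w (fun l => eval_term (f l) rho).
Proof.
elim: w => //= g t IHt u IHu; apply: funext => kappa.
by rewrite IHt; congr eval_term; apply: funext => a; rewrite IHu.
Qed.

Lemma eval_term_relabel w f rho : eval_term (relabel f w) rho = eval_term w (rho \o f).
Proof. exact: eval_term_bind. Qed.

Lemma eq_in_eval_term w rho rho' :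
  {in labels w, rho =1 rho'} -> eval_term w rho = eval_term w rho'.
Proof.
elim: w => [l|g t IHt u IHu] /= H; first by rewrite H ?inE.
rewrite IHt ?IHu // => l Hl; apply: H; by rewrite mem_cat Hl ?orbT.
Qed.

Lemma eval_term_linear w rho : (forall l, linear_form (rho l)) ->
  linear_form (eval_term w rho).
Proof.
move=> Lr; elim: w => //= g t IHt u IHu a k1 k2; rewrite -IHt; congr eval_term.
by apply: funext => x; rewrite -IHu.
Qed.

(** Input [i] occurs exactly once in [w], so evaluation is linear in its value. The sum crosses the
    inputs to its left because their values are linear forms. *)
Lemma eval_term_sum w i (J : Type) (r : seq J) (a : J -> K) (L : J -> functional) rho kappa :
  (forall l, linear_form (rho l)) -> uniq (labels w) -> i \in labels w ->
  \sum_(j <- r) a j * eval_term w (fun l => if l == i then L j else rho l) kappa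
  = eval_term w (fun l => if l == i then fun k => \sum_(j <- r) a j * L j k else rho l) kappa.
Proof.
move=> Lr; elim: w kappa => [l|g t IHt u IHu] kappa /=.
  by rewrite inE eq_sym => _ /eqP ->; rewrite eqxx.
rewrite cat_uniq mem_cat => /and3P[ut /hasPn dis uu].
have evi v L' : i \notin labels v ->
    eval_term v (fun l => if l == i then L' else rho l) = eval_term v rho.
  move=> iv; apply: eq_in_eval_term => l lv; rewrite ifN //.
  by apply: contraNneq iv => <-.
have [it _|it /= iu] := boolP (i \in labels t).
  have iu : i \notin labels u by apply/negP => /dis /=; rewrite it.
  rewrite -IHt //; apply: eq_bigr => j _; rewrite !(evi u) //.
pose F x j := eval_term u (fun l => if l == i then L j else rho l)
  (fun b => kappa (mul g x b)).
rewrite (evi t) //; transitivity (eval_term t rho (fun x => \sum_(j <- r) a j * F x j)).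
  rewrite linear_form_sum; last exact: eval_term_linear.
  by apply: eq_bigr => j _; rewrite (evi t).
by congr eval_term; apply: funext => x; rewrite -IHu.
Qed.

Definition eval_free k (x : F k) rho kappa : K :=
  extend (V := K^o) (fun w => eval_term w rho kappa) x.

Lemma eval_free_linear k rho kappa : linear (fun x : F k => eval_free x rho kappa : K^o).
Proof. exact: extend_linear. Qed.

Lemma eval_free_linear_form k (x : F k) rho : (forall l, linear_form (rho l)) ->
  linear_form (eval_free x rho).
Proof.
move=> Lr a k1 k2; rewrite /eval_free /extend mulr_sumr -big_split.
apply: eq_bigr => w _; rewrite (eval_term_linear _ Lr) /= scalerDr; congr (_ + _).
by rewrite /GRing.scale /= mulrCA.
Qed.

Lemma eval_free_mon k t rho : multilinear k t -> eval_free (mon K k t) rho = eval_term t rho.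
Proof. by move=> kt; apply: funext => kappa; rewrite /eval_free extend_mon. Qed.

Lemma eval_free_act k (s : 'S_k) (x : F k) rho :
  eval_free (free_act s x) rho = eval_free x (rho \o permn s).
Proof.
apply: funext => kappa; rewrite /free_act.
rewrite (linear_extend _ _ (eval_free_linear rho kappa)) [RHS]/eval_free.
apply: (@eq_extend K generator _ K^o) => t kt.
by rewrite eval_free_mon ?eval_term_relabel //; apply: relabel_multilinear.
Qed.

Lemma eval_free_comp k m (i : 'I_k) (x : F k) (y : F m) rho :
  (forall l, linear_form (rho l)) ->
  eval_free (free_comp i x y) rho
  = eval_free x (fun l => if l == i then eval_free y (rho \o addn i) else rho (outer m i l)).
Proof.
move=> Lr; apply: funext => kappa; rewrite /free_comp.
rewrite (linear_extend _ _ (eval_free_linear rho kappa)) [RHS]/eval_free.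
apply: (@eq_extend K generator _ K^o) => s ks.
rewrite (linear_extend _ _ (eval_free_linear rho kappa)).
transitivity (extend (V := K^o) (fun t => eval_term s (fun l =>
    if l == i then eval_term t (rho \o addn i) else rho (outer m i l)) kappa) y).
  apply: (@eq_extend K generator _ K^o) => t mt.
  rewrite eval_free_mon ?eval_term_bind; last exact: graft_multilinear.
  congr eval_term; apply: funext => l; by case: eqP => // _; rewrite eval_term_relabel.
apply: (@eval_term_sum s i _ _ _ (fun w : mono generator m => eval_term (val w) (rho \o addn i))
  (fun l => rho (outer m i l))) => //.
- by rewrite (perm_uniq ks) iota_uniq.
- by rewrite (multilinearP _ ks).
Qed.

(** Each relation is [mulA] for one of the three pairs satisfying [rassoc]. *)
Lemma eval_free_relation k (y : F k) : relation_ne y ->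
  forall rho kappa, eval_free y rho kappa = 0.
Proof.
have E a b rho kappa : rassoc a b ->
    eval_free (compL (gen K b) (gen K a)) rho kappa
    = eval_free (compR (gen K a) (gen K b)) rho kappa.
  move=> ab; rewrite /compL /compR /= !free_comp_mon // !eval_free_mon //=.
  do 3![congr (rho _ _); apply: funext => ?]; by rewrite mulA.
have EB k' (x z : F k') rho kappa :
    eval_free x rho kappa = eval_free z rho kappa -> eval_free (x - z) rho kappa = 0.
  by move=> xz; rewrite (linB x z (eval_free_linear rho kappa)) xz subrr.
by case=> rho kappa; apply: EB; rewrite E.
Qed.

(** The independence of normal trees in disguise: evaluation descends to [P_ne]. *)
Lemma eval_free_ideal k (x : F k) rho kappa : ideal_gen (@relation_ne K) x ->
  (forall l, linear_form (rho l)) -> eval_free x rho kappa = 0.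
Proof.
(* All families of linear forms are taken at once, because the action and the composition replace
   [rho] by another family. *)
move=> Ix Lr; pose I n (y : F n) := forall rho' : nat -> functional,
  (forall l, linear_form (rho' l)) -> eval_free y rho' = fun=> 0.
suff : I k x by move=> ->.
apply: Ix => [|m y Ry rho' _]; last first.
  by apply: funext => kappa'; apply: eval_free_relation.
have e0 n rho' : eval_free (0 : F n) rho' = fun=> 0.
  apply: funext => k'; rewrite -(subrr 0) (linB _ _ (eval_free_linear rho' k')).
  by rewrite subrr.
split=> [n rho' _|n a y z Iy Iz rho' Lr'|n s y Iy rho' Lr'||].
- exact: e0.
- apply: funext => k'.
  by rewrite (eval_free_linear rho' k' a y z) Iy // Iz // scaler0 addr0.
- by rewrite eval_free_act Iy // => l; apply: Lr'.
- move=> n m i y z Iy rho' Lr'; rewrite /= eval_free_comp // Iy // => l.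
  by case: eqP => // _; apply: eval_free_linear_form => l'; apply: Lr'.
move=> n m i y z Iz rho' Lr'; rewrite /= eval_free_comp // Iz => [|l]; last exact: Lr'.
have := eval_free_comp i y (0 : F m) Lr'; rewrite e0 => <-.
rewrite (_ : free_comp i y 0 = 0) // -(subrr 0).
by rewrite (linB _ _ (free_comp_linearr i y)) subrr.
Qed.

Definition eval_op k (p : P k) rho kappa : K := eval_free (qlift p) rho kappa.

Lemma eval_op_proj k (x : F k) rho : (forall l, linear_form (rho l)) ->
  eval_op (qproj (@relation_ne K) x : P k) rho = eval_free x rho.
Proof.
move=> Lr; apply: funext => kappa; apply/eqP; rewrite -subr_eq0; apply/eqP.
rewrite -(linB _ _ (eval_free_linear rho kappa)); apply: eval_free_ideal => //.
by apply/qproj_eq; rewrite qliftK.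
Qed.

Lemma eval_op_linear k rho kappa : (forall l, linear_form (rho l)) ->
  linear (fun p : P k => eval_op p rho kappa : K^o).
Proof.
move=> Lr a p q; rewrite -[p]qliftK -[q]qliftK -qproj_linear !eval_op_proj //.
exact: eval_free_linear.
Qed.

Lemma eval_op_act k (s : 'S_k) (p : P k) rho : (forall l, linear_form (rho l)) ->
  eval_op (act s p) rho = eval_op p (rho \o permn s).
Proof. by move=> Lr; rewrite eval_op_proj // eval_free_act. Qed.

Lemma eval_op_comp k m (i : 'I_k) (p : P k) (q : P m) rho :
  (forall l, linear_form (rho l)) ->
  eval_op (comp i p q) rho
  = eval_op p (fun l => if l == i then eval_op q (rho \o addn i) else rho (outer m i l)).
Proof. by move=> Lr; rewrite eval_op_proj // eval_free_comp. Qed.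
End Evaluation.

Section TreeEvaluation.
Variable K : fieldType.
Local Notation P := (P_ne K).
Local Notation functional := ((mterm -> K) -> K).
Implicit Types (L : functional) (rho : nat -> functional) (kappa : mterm -> K).
Implicit Types (T : tree P) (c : child (tree P)) (s : seq (child (tree P))).

(** The default of [nth] is the value of [Leaf _ 0], so that the inputs agree with [eval_children]
    at every position. *)
Fixpoint eval_tree T : functional :=
  let: Vtx k p s := T in
  eval_op p (nth (fun kappa => kappa (Lf _ 0%N))
    [seq match c with
         | Leaf l => fun kappa => kappa (Lf _ l)
         | Edge e u => fun kappa => eval_tree u (fun t => kappa (set_mark (Some e) t))
         end | c <- s]).

Definition eval_child c : functional := match c with
  | Leaf l => fun kappa => kappa (Lf _ l)
  | Edge e u => fun kappa => eval_tree u (fun t => kappa (set_mark (Some e) t))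
  end.

Definition eval_children s (l : nat) : functional := eval_child (nth (Leaf _ 0) s l).

Lemma eval_treeE k (p : P k) s : eval_tree (Vtx p s) = eval_op p (eval_children s).
Proof.
rewrite /=; congr eval_op; apply: funext => l; rewrite /eval_children.
by elim: s l => [|c s IH] [|l] /=.
Qed.

Lemma eval_op_linear_form k (p : P k) rho : (forall l, linear_form (rho l)) ->
  linear_form (eval_op p rho).
Proof. exact: eval_free_linear_form. Qed.

Lemma eval_tree_linear T : linear_form (eval_tree T).
Proof.
elim/tree_ind_nth: T => k p s IH; rewrite eval_treeE; apply: eval_op_linear_form => l.
rewrite /eval_children; case E: (nth _ s l) => [l'|e u] //= a k1 k2.
exact: (IH _ _ _ E).
Qed.

Lemma eval_children_linear s l : linear_form (eval_children s l).
Proof. by rewrite /eval_children; case: nth => [l'|e u] //= a k1 k2; apply: eval_tree_linear. Qed.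

(** The combination represented by [L] involves only terms satisfying [Q]. Identities such as
    [recut_kill] need normal terms, so evaluations are compared on supports. *)
Definition supported L (Q : mterm -> Prop) := forall kappa1 kappa2,
  (forall t, Q t -> kappa1 t = kappa2 t) -> L kappa1 = L kappa2.

Fixpoint terms_over (w : term generator) (Q : nat -> mterm -> Prop) (t : mterm) :=
  match w with
  | Lf l => Q l t
  | Nd g v u => exists a b, [/\ terms_over v Q a, terms_over u Q b & t = mul g a b]
  end.

Lemma supported_eval_term w rho Q : {in labels w, forall l, supported (rho l) (Q l)} ->
  supported (eval_term w rho) (terms_over w Q).
Proof.
elim: w => [l|g t IHt u IHu] /= H; first by apply: H; rewrite inE.
move=> k1 k2 k12; apply: IHt => [l Hl|a Qa].
  by apply: H; rewrite mem_cat Hl.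
apply: IHu => [l Hl|b Qb]; first by apply: H; rewrite mem_cat Hl orbT.
by apply: k12; exists a, b.
Qed.

Lemma supported_eval_op k (p : P k) rho Q Q' :
  (forall l, (l < k)%N -> supported (rho l) (Q l)) ->
  (forall w t, multilinear k w -> terms_over w Q t -> Q' t) ->
  supported (eval_op p rho) Q'.
Proof.
move=> H HQ k1 k2 k12; apply: (@eq_extend K generator _ K^o) => w kw.
apply: (@supported_eval_term _ _ Q) => [l|t wt]; first by rewrite (multilinearP _ kw); apply: H.
by apply: k12; apply: HQ wt.
Qed.

Definition carried (ls es : seq nat) (t : mterm) :=
  [/\ is_nf t, perm_eq (labels t) ls & perm_eq (marks t) es].

(** Such a term, a leaf or a node whose edge is cut, fills one input of the vertex that carries
    it. *)
Definition atomic (t : mterm) := is_node t ==> mark t.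

Definition child_term c t := atomic t /\ carried (cleaves c) (cedges c) t.

Definition tree_term T t :=
  [/\ is_node t, mark t = None & carried (leaves T) (edges T) t].

Lemma terms_over_carried w s t :
  terms_over w (fun l => child_term (nth (Leaf _ 0) s l)) t ->
  carried (flatten [seq cleaves (nth (Leaf _ 0) s l) | l <- labels w])
          (flatten [seq cedges (nth (Leaf _ 0) s l) | l <- labels w]) t.
Proof.
elim: w t => [l|g v IHv u IHu] t /=; first by rewrite !cats0 => -[].
move=> [a [b [/IHv [na la ma] /IHu [nb lb mb] ->]]]; split.
- exact: is_nf_mul.
- by rewrite labels_mul map_cat flatten_cat perm_cat.
by rewrite marks_mul map_cat flatten_cat perm_cat.
Qed.

Lemma terms_over_node w Q t : (1 < size (labels w))%N -> terms_over w Q t ->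
  is_node t /\ mark t = None.
Proof.
by case: w => //= g v u _ [a [b [_ _ ->]]]; rewrite is_node_mul mark_mul.
Qed.

Lemma supported_eval_child c : creduced c ->
  (forall e u, c = Edge e u -> reduced u -> supported (eval_tree u) (tree_term u)) ->
  supported (eval_child c) (child_term c).
Proof.
case: c => [l|e u] /= rc H k1 k2 k12; first exact: k12.
apply: (H e u) => // t [nt mt [nrt lt et]]; apply: k12; split.
  by rewrite /atomic mark_set_mark ?implybT.
split; rewrite ?is_nf_set_mark ?labels_set_mark //.
by rewrite marks_set_mark // perm_cons.
Qed.

Lemma supported_eval_tree T : reduced T -> supported (eval_tree T) (tree_term T).
Proof.
elim/tree_ind_nth: T => k p s IH; rewrite reducedE => /and3P[k1 /eqP sk rs].
rewrite eval_treeE; apply: (@supported_eval_op _ _ _ (fun l => child_term (nth (Leaf _ 0) s l))).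
  move=> l; rewrite -sk => ls; rewrite /eval_children.
  by apply: supported_eval_child; [exact: (all_nthP (Leaf _ 0) rs)|exact: IH].
move=> w t kw wt.
have [|nt mt] := terms_over_node _ wt; first by rewrite (perm_size kw) size_iota.
have [nrt lt et] := terms_over_carried wt; split=> //; split=> //.
  apply: perm_trans lt _; rewrite leavesE -map_nth_iota sk.
  by apply: perm_flatten; apply: perm_map.
apply: perm_trans et _; rewrite edgesE -map_nth_iota sk.
by apply: perm_flatten; apply: perm_map.
Qed.

Lemma supported_eval_children s l : all (@creduced K P) s -> (l < size s)%N ->
  supported (eval_children s l) (child_term (nth (Leaf _ 0) s l)).
Proof.
move=> rs ls; apply: supported_eval_child => [|e u _]; last exact: supported_eval_tree.
exact: (all_nthP (Leaf _ 0) rs).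
Qed.

Lemma eval_term_hom (h : mterm -> mterm) w rho kappa :
  (forall g a b, h (mul g a b) = mul g (h a) (h b)) ->
  eval_term w rho (kappa \o h) = eval_term w (fun l k => rho l (k \o h)) kappa.
Proof.
move=> hM; elim: w kappa => //= g t IHt u IHu kappa; rewrite -IHt.
congr eval_term; apply: funext => a; rewrite /= -IHu; congr eval_term.
by apply: funext => b; rewrite /= hM.
Qed.

Lemma eval_op_hom (h : mterm -> mterm) k (p : P k) rho kappa :
  (forall g a b, h (mul g a b) = mul g (h a) (h b)) ->
  eval_op p rho (kappa \o h) = eval_op p (fun l k => rho l (k \o h)) kappa.
Proof.
by move=> hM; apply: (@eq_extend K generator _ K^o) => w _; apply: eval_term_hom.
Qed.

Lemma eq_eval_op k (p : P k) rho rho' kappa :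
  (forall l, (l < k)%N -> rho l = rho' l) -> eval_op p rho kappa = eval_op p rho' kappa.
Proof.
move=> H; apply: (@eq_extend K generator _ K^o) => w kw; congr (_ kappa).
by apply: eq_in_eval_term => l; rewrite (multilinearP _ kw); apply: H.
Qed.

Lemma eval_tree_renumber f T kappa :
  eval_tree (renumber f T) kappa = eval_tree T (kappa \o map_marks (Some \o f)).
Proof.
elim/tree_ind_nth: T kappa => k p s IH kappa.
rewrite (_ : renumber f (Vtx p s) = Vtx p [seq match c with
  | Leaf l => Leaf _ l | Edge e u => Edge (f e) (renumber f u) end | c <- s]) //.
rewrite !eval_treeE eval_op_hom; last by move=> g a b; exact: map_marks_mul.
congr eval_op; apply: funext => l; apply: funext => k'; rewrite /eval_children.
have -> : nth (Leaf _ 0) [seq match c with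
  | Leaf l => Leaf _ l | Edge e u => Edge (f e) (renumber f u) end | c <- s] l
  = match nth (Leaf _ 0) s l with
  | Leaf l => Leaf _ l | Edge e u => Edge (f e) (renumber f u) end.
  by elim: s l {IH} => [|c s IHs] [|l] //=.
case E: (nth _ s l) => [l'|e u] //=; rewrite (IH _ _ _ E).
by congr eval_tree; apply: funext => t /=; rewrite map_marks_set_mark.
Qed.

Definition kill e := fun e' : nat => if e' == e then None else Some e'.

Lemma recut_kill e t : is_nf t -> e \notin marks t -> recut (kill e) t = t.
Proof.
move=> nt et; rewrite /recut (eq_in_map_marks (f' := Some)) ?map_marks_Some ?nf_id //
  => e' He'.
by rewrite /kill ifN //; apply: contraNneq et => <-.
Qed.

Lemma eval_child_kill e c kappa : creduced c -> e \notin cedges c ->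
  eval_child c (kappa \o recut (kill e)) = eval_child c kappa.
Proof.
case: c => //= e' u ru; rewrite inE negb_or => /andP[ee' eu].
apply: (supported_eval_tree ru) => t [nt mt [nrt _ et]] /=; rewrite recut_kill //.
  by rewrite is_nf_set_mark.
by rewrite marks_set_mark //= inE negb_or ee' (perm_mem et).
Qed.

Lemma eval_tree_kill e T kappa : reduced T -> e \notin edges T ->
  eval_tree T (kappa \o recut (kill e)) = eval_tree T kappa.
Proof.
move=> rT eT; apply: (supported_eval_tree rT) => t [_ _ [nt _ et]] /=.
by rewrite recut_kill // (perm_mem et).
Qed.

(** At the vertex carrying [e], composing the decorations leaves the product of the expansions with
    one mark fewer. Every other vertex is crossed because [recut (kill e)] is a morphism for [mul];
    as [e] occurs only once, the other children are unaffected. *)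
Lemma eval_tree_contract e T kappa : reduced T -> uniq (edges T) ->
  eval_tree (contract e T) kappa = eval_tree T (kappa \o recut (kill e)).
Proof.
elim/tree_ind_nth: T kappa => k p s IH kappa rT uT.
have := rT; rewrite reducedE => /and3P[k1 /eqP sk rs].
have [hs|hs] := boolP (has (is_edge e) s); last first.
  rewrite contract_hasN // !eval_treeE eval_op_hom; last by move=> g a b; exact: recut_mul.
  apply: eq_eval_op => l; rewrite -sk => ls; apply: funext => k'; rewrite /eval_children.
  rewrite (nth_map (Leaf _ 0)) //.
  have := all_nthP (Leaf _ 0) rs l ls.
  have := uniq_cedges l uT.
  have := all_nthP (Leaf _ 0) (_ : all (predC (is_edge e)) s) l ls.
  rewrite all_predC hs => /(_ isT).
  case E: (nth _ s l) => [l'|e' u] //= ee' /andP[_ uu] ru.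
  rewrite (IH _ _ _ E) //; apply: (supported_eval_tree ru) => t [nt mt _] /=.
  by rewrite recut_set_mark //= /kill eq_sym (negPf ee').
have [i [m [q [s' [nE ->]]]]] := contract_has rT hs.
have is_ : (i < size s)%N by rewrite sk.
have ru : reduced (Vtx q s').
  by have := all_nthP (Leaf _ 0) rs i is_; rewrite nE.
have := ru; rewrite reducedE => /and3P[m1 /eqP sm rs'].
have /andP[eu uu] : uniq (e :: edges (Vtx q s')).
  by have := uniq_cedges i uT; rewrite nE.
rewrite eval_treeE eval_op_comp; last by move=> l; apply: eval_children_linear.
rewrite eval_treeE eval_op_hom; last by move=> g a b; exact: recut_mul.
apply: eq_eval_op => l lk; apply: funext => k'.
have ls : (l < size s)%N by rewrite sk.
have size_take_i : size (take i s) = i by rewrite size_take is_.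
case: eqVneq => [->|li].
  rewrite /eval_children nE /=.
  transitivity (eval_tree (Vtx q s') k').
    rewrite eval_treeE; apply: eq_eval_op => l'; rewrite -sm => ls' /=; rewrite /eval_children.
    by rewrite nth_cat size_take_i ltnNge leq_addr /= addKn nth_cat ls'.
  rewrite -(eval_tree_kill _ ru eu); apply: (supported_eval_tree ru) => t [nt mt _] /=.
  rewrite recut_set_mark //= /kill eqxx /=.
  rewrite -{2}(_ : mark (recut (kill e) t) = None) ?set_mark_mark //.
  by rewrite mark_nf mark_map_marks mt.
rewrite /eval_children -/eval_child.
have -> : nth (Leaf _ 0) (take i s ++ s' ++ drop i.+1 s) (outer m i l)
    = nth (Leaf _ 0) s l.
  rewrite /outer nth_cat size_take_i; case: (ltnP l i) => [li'|il].
    by rewrite li' nth_take.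
  rewrite ifN; last by lia.
  rewrite nth_cat ifN; last by lia.
  by rewrite nth_drop; congr nth; lia.
rewrite eval_child_kill //; first exact: (all_nthP (Leaf _ 0) rs).
apply/negP => el; move/eqP: li; apply; apply: (uniq_edges_nth uT ls is_ el).
by rewrite nE inE eqxx.
Qed.

End TreeEvaluation.

(** * Rewriting in the operad *)

Section Planar.
Local Open Scope nat_scope.
Variable G : finType.
Implicit Types t u : term G.

Definition nleaves t := size (labels t).

Fixpoint planar o t : term G :=
  match t with
  | Lf _ => Lf _ o
  | Nd g t u => Nd g (planar o t) (planar (o + nleaves t) u)
  end.

Lemma nleavesN g t u : nleaves (Nd g t u) = (nleaves t + nleaves u).
Proof. exact: size_cat. Qed.

Lemma labels_planar o t : labels (planar o t) = iota o (nleaves t).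
Proof. by elim: t o => //= g t IHt u IHu o; rewrite IHt IHu -iotaD nleavesN. Qed.

Lemma planar_multilinear t n : n = nleaves t -> multilinear n (planar 0 t).
Proof. by move=> ->; rewrite /multilinear labels_planar. Qed.

Lemma bind_planar o o' f t : (forall i, (i < nleaves t) -> f (o + i) = Lf _ (o' + i)) ->
  bind (planar o t) f = planar o' t.
Proof.
elim: t o o' => [l|g t IHt u IHu] o o' H /=.
  by have := H 0 isT; rewrite !addn0.
rewrite (IHt o o') ?(IHu _ (o' + nleaves t)) // => i it.
  by rewrite -!addnA H // nleavesN ltn_add2l.
by rewrite H // nleavesN ltn_addr.
Qed.

Lemma relabel_planar o f t :
  (forall i, (i < nleaves t) -> f (o + i) = nth 0 (labels t) i) ->
  relabel f (planar o t) = t.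
Proof.
elim: t o => [l|g t IHt u IHu] o H.
  by rewrite /relabel /=; have := H 0 isT; rewrite addn0 => ->.
rewrite /relabel /= [bind _ _]IHt ?[bind _ _]IHu // => i it.
  by rewrite -addnA H ?nleavesN ?ltn_add2l //= nth_cat ltnNge leq_addr addKn.
by rewrite H ?nleavesN ?ltn_addr //= nth_cat it.
Qed.

End Planar.

Section Classes.
Local Open Scope nat_scope.
Variable K : fieldType.
Local Notation F := (free K generator).
Local Notation P := (P_ne K).
Implicit Types t u v : term generator.

Local Notation monF :=
  (@mon K generator : forall n, term generator -> free_operad K generator n).

Definition mon_class n t : P n := qproj (@relation_ne K) (monF n t).
Definition planar_class n t : P n := mon_class n (planar 0 t).

Lemma mon_class_comp k m (i : 'I_k) t u : multilinear k t -> multilinear m u ->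
  comp i (mon_class k t) (mon_class m u) = mon_class (k + m).-1 (graft i m t u).
Proof.
move=> kt mu; apply: etrans (quot_comp_proj _ i (monF k t) (monF m u)) _.
by rewrite /mon_class -free_comp_mon.
Qed.

Lemma mon_class_act k (s : 'S_k) t : multilinear k t ->
  act s (mon_class k t) = mon_class k (relabel (permn s) t).
Proof.
move=> kt; apply: etrans (quot_act_proj _ s (monF k t)) _.
by rewrite /mon_class -free_act_mon.
Qed.

Lemma graft_eq k m (i : 'I_k) t t' u u' : 
  multilinear k t -> multilinear k t' -> multilinear m u -> multilinear m u' ->
  mon_class k t = mon_class k t' -> mon_class m u = mon_class m u' ->
  mon_class (k + m).-1 (graft i m t u) = mon_class (k + m).-1 (graft i m t' u').
Proof. by move=> kt kt' mu mu' tt' uu'; rewrite -!mon_class_comp // tt' uu'. Qed.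

(** The equation on [n] allows the comparison of classes whose arities are equal but not
    convertible. *)
Definition same_class t u :=
  nleaves t = nleaves u /\ forall n, n = nleaves t -> planar_class n t = planar_class n u.

Lemma same_class_refl t : same_class t t. Proof. by []. Qed.

Lemma same_class_sym t u : same_class t u -> same_class u t.
Proof. by move=> [tu H]; split=> // n nu; rewrite H // tu. Qed.

Lemma same_class_trans t u v : same_class t u -> same_class u v -> same_class t v.
Proof.
move=> [tu H] [uv H']; split=> [|n nt]; first by rewrite tu.
by rewrite H // H' // -tu.
Qed.

Lemma same_class_node g t t' u u' : same_class t t' -> same_class u u' ->
  same_class (Nd g t u) (Nd g t' u').
Proof.
move=> [tt' Ht] [uu' Hu]; split=> [|n]; first by rewrite !nleavesN tt' uu'.
rewrite nleavesN => nE.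
(* [Nd g t u] is the generator with [u] grafted at input 1, then [t] at input 0: filling from the
   right keeps the remaining inputs unshifted. *)
pose S w := graft 1 (nleaves u) (Nd g (Lf _ 0) (Lf _ 1)) (planar 0 w).
have graftE v w : nleaves v = nleaves t ->
    graft 0 (nleaves t) (S w) (planar 0 v) = planar 0 (Nd g v w).
  move=> vt; rewrite /S /graft /= bindA; congr (Nd _ _ _); first exact: bind_planar.
  by apply: bind_planar => i _; rewrite /= /outer; congr Lf; lia.
have pt v w : nleaves v = nleaves w -> multilinear (nleaves v) (planar 0 w).
  exact: planar_multilinear.
have mS w : nleaves u = nleaves w -> multilinear (2 + nleaves u).-1 (S w).
  by move=> uw; apply: (@graft_multilinear _ 2 _ 1) => //; apply: pt.
have HS : mon_class (2 + nleaves u).-1 (S u) = mon_class (2 + nleaves u).-1 (S u').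
  by apply: (@graft_eq 2 _ (ord_max)) => //; [apply: pt|apply: pt|apply: Hu].
rewrite /planar_class -!graftE //.
have -> : n = ((2 + nleaves u).-1 + nleaves t).-1 by rewrite nE /=; lia.
apply: (graft_eq (ord0 : 'I_(1 + nleaves u)) _ _ _ _ HS (Ht _ erefl));
  [exact: mS|exact: mS|exact: pt|exact: pt].
Qed.

Lemma mon_class_rotation a b : rassoc a b ->
  mon_class 3 (Nd b (Nd a (Lf _ 0) (Lf _ 1)) (Lf _ 2))
  = mon_class 3 (Nd a (Lf _ 0) (Nd b (Lf _ 1) (Lf _ 2))).
Proof.
move=> ab.
have Ec x y : compL (gen K x) (gen K y)
    = mon K 3 (Nd x (Nd y (Lf _ 0) (Lf _ 1)) (Lf _ 2)).
  by rewrite /compL /= free_comp_mon.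
have Er x y : compR (gen K x) (gen K y)
    = mon K 3 (Nd x (Lf _ 0) (Nd y (Lf _ 1) (Lf _ 2))).
  by rewrite /compR /= free_comp_mon.
have rel x y : @relation_ne K 3 (x - y)%R ->
    qproj (@relation_ne K) x = qproj (@relation_ne K) y.
  by move=> Rxy; apply/qproj_eq => I _; apply.
rewrite /mon_class -Ec -Er.
case: a b ab => [] [] // _.
- by apply: rel; apply: m_m.
- by apply/esym/rel/ne_m.
by apply: rel; apply: ne_ne.
Qed.

(** The relation in arity 3, composed with [v], [u] and [t] at inputs 2, 1 and 0. *)
Lemma same_class_rotation a b t u v : rassoc a b ->
  same_class (Nd b (Nd a t u) v) (Nd a t (Nd b u v)).
Proof.
move=> ab; split=> [|n]; first by rewrite !nleavesN addnA.
rewrite !nleavesN => nE.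
have pl w : multilinear (nleaves w) (planar 0 w) by apply: planar_multilinear.
pose S T := graft 1 (nleaves u) (graft 2 (nleaves v) T (planar 0 v)) (planar 0 u).
have m1 T : multilinear 3 T ->
    multilinear (3 + nleaves v).-1 (graft 2 (nleaves v) T (planar 0 v)).
  by move=> T3; apply: (@graft_multilinear _ 3 _ 2).
have mS T : multilinear 3 T -> multilinear ((3 + nleaves v).-1 + nleaves u).-1 (S T).
  by move=> T3; apply: graft_multilinear => //; apply: m1.
have -> : n = (((3 + nleaves v).-1 + nleaves u).-1 + nleaves t).-1.
  by rewrite nE /=; lia.
have := mon_class_rotation ab; set T1 := Nd b _ _; set T2 := Nd a _ _ => H.
have HS : mon_class ((3 + nleaves v).-1 + nleaves u).-1 (S T1) = mon_class _ (S T2).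
  apply: (graft_eq (@Ordinal (3 + nleaves v).-1 1 isT)) => //; try exact: m1.
  exact: (graft_eq (ord_max : 'I_3)).
have ti : 0 < ((3 + nleaves v).-1 + nleaves u).-1 by [].
have := graft_eq (Ordinal ti) (mS T1 isT) (mS T2 isT) (pl _ t) (pl _ t) HS erefl.
rewrite /planar_class; congr (mon_class _ _ = mon_class _ _);
  rewrite /S ?/T1 ?/T2 /graft /= /relabel !bindA /=;
  [congr (Nd _ (Nd _ _ _) _) | congr (Nd _ _ (Nd _ _ _))];
  apply: bind_planar => i _; rewrite /= /outer /=; rewrite ?nleavesN; congr Lf; lia.
Qed.

End Classes.

(** * Trees cut out of marked terms *)

Section Cutting.
Variable K : fieldType.
Local Notation P := (P_ne K).
Local Notation fragment := (term generator * seq (child (tree P)))%type.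
Implicit Types (t u : mterm) (r : fragment).

(** A fragment is a vertex still growing: the shape of its decoration and its children from left to
    right. The leaf labels of the shape are placeholders, which [planar] overwrites. *)
Definition vertex r : tree P := Vtx (planar_class K (size r.2) r.1) r.2.

Definition cut t r : fragment :=
  if mark t is Some e then (Lf _ 0%N, [:: Edge e (vertex r)]) else r.

Definition glue g r r' : fragment := (Nd g r.1 r'.1, r.2 ++ r'.2).

Fixpoint frag t : fragment :=
  match t with
  | Lf l => (Lf _ 0%N, [:: Leaf _ l])
  | Nd (_, g) x y => glue g (cut x (frag x)) (cut y (frag y))
  end.

Definition child_frag t := cut t (frag t).

Definition cut_tree t : tree P := vertex (frag t).

Lemma frag_set_mark e t : frag (set_mark e t) = frag t.
Proof. by case: t => //= -[]. Qed.

Lemma child_frag_None t : mark t = None -> child_frag t = frag t.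
Proof. by rewrite /child_frag /cut => ->. Qed.

Lemma child_frag_Some e t : is_node t ->
  child_frag (set_mark (Some e) t) = (Lf _ 0%N, [:: Edge e (cut_tree t)]).
Proof. by move=> nt; rewrite /child_frag /cut mark_set_mark // frag_set_mark. Qed.

Lemma frag_node e g x y : frag (Nd (e, g) x y) = glue g (child_frag x) (child_frag y).
Proof. by []. Qed.

Lemma size_frag t : size (frag t).2 = nleaves (frag t).1.
Proof.
elim: t => // -[e g] x IHx y IHy; rewrite frag_node /= size_cat nleavesN.
by rewrite /child_frag /cut; case: (mark x) => [?|]; case: (mark y) => [?|] /=;
   rewrite ?IHx ?IHy.
Qed.

Lemma size_child_frag t : size (child_frag t).2 = nleaves (child_frag t).1.
Proof. by rewrite /child_frag /cut; case: mark => [e|] //=; apply: size_frag. Qed.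

Definition same_fragment r r' := same_class K r.1 r'.1 /\ r.2 = r'.2.

(** Soundness of rewriting: [mul] rotates only inside the root vertex, so it keeps the list of
    children and changes the decoration by relations of the operad. *)
Lemma frag_mul g t u : same_fragment (frag (mul g t u)) (glue g (child_frag t) (child_frag u)).
Proof.
have H v : same_fragment (frag (Nd (None, g) v u)) (glue g (child_frag v) (child_frag u)) by [].
elim: t {H}(H t) => [l|[[e|] a] x _ y IH] //= _.
case: ifP => // ag; rewrite !frag_node (child_frag_None (mark_mul g y u)).
have [] := IH; first by [].
rewrite /glue /= => sy ->; split=> /=; last by rewrite catA.
apply: same_class_trans (same_class_node a (same_class_refl K _) sy) _.
exact/same_class_sym/same_class_rotation.
Qed.

Lemma child_frag_mul2 g t u : (child_frag (mul g t u)).2 = (child_frag t).2 ++ (child_frag u).2.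
Proof. by rewrite child_frag_None ?mark_mul //; have [_ ->] := frag_mul g t u. Qed.

(** Atomic inputs contribute one leaf each, so the root vertex of [t] has a shape obtained from [w]
    by rewriting alone. *)
Lemma terms_over_same_class w Q t : (forall l t, Q l t -> atomic t) ->
  terms_over w Q t -> same_class K (child_frag t).1 w.
Proof.
move=> HQ; elim: w t => [l|g v IHv u IHu] t /=.
  move=> /HQ; rewrite /atomic; case: t => [l' _|[e g] x y] //=.
  by rewrite /child_frag /cut /=; case: e.
move=> [a [b [/IHv sa /IHu sb ->]]]; rewrite child_frag_None ?mark_mul //.
have [sg _] := frag_mul g a b; apply: same_class_trans sg _; exact: same_class_node.
Qed.

Lemma leaves_frag t : flatten (map (@cleaves K P) (frag t).2) = labels t.
Proof.
elim: t => // -[e g] x IHx y IHy; rewrite frag_node /= map_cat flatten_cat.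
have E v : flatten (map (@cleaves K P) (frag v).2) = labels v ->
    flatten (map (@cleaves K P) (child_frag v).2) = labels v.
  by rewrite /child_frag /cut; case: mark => [e'|] //= <-; rewrite cats0.
by rewrite !E.
Qed.

Lemma edges_child_frag t : flatten (map (@cedges K P) (child_frag t).2) = marks t.
Proof.
elim: t => // -[e g] x IHx y IHy /=.
have E : flatten (map (@cedges K P) (frag (Nd (e, g) x y)).2) = marks x ++ marks y.
  by rewrite frag_node map_cat flatten_cat IHx IHy.
by rewrite /child_frag /cut /= -E; case: e {E} => [e|] //=; rewrite cats0.
Qed.

Lemma leaves_child_frag t : flatten (map (@cleaves K P) (child_frag t).2) = labels t.
Proof.
rewrite /child_frag /cut; case: mark => [e|] /=; last exact: leaves_frag.
by rewrite cats0; apply: leaves_frag.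
Qed.

Lemma leaves_cut_tree t : leaves (cut_tree t) = labels t.
Proof. exact: leaves_frag. Qed.

Lemma edges_cut_tree t : edges (cut_tree t) = marks (set_mark None t).
Proof.
rewrite -edges_child_frag /child_frag /cut frag_set_mark.
by case: t => //= -[].
Qed.

Lemma reduced_frag t : all (@creduced K P) (frag t).2.
Proof.
have E v : all (@creduced K P) (frag v).2 -> all (@creduced K P) (child_frag v).2.
  rewrite /child_frag /cut; case mv: (mark v) => [e'|] // rv.
  rewrite -[all _ _]/(reduced (vertex (frag v)) && true) andbT.
  rewrite /vertex reducedE eqxx rv !andbT.
  case: v mv {rv} => // -[e g] x y _; rewrite frag_node size_cat !size_child_frag.
  by apply: (@leq_add 1 1); apply: size_labels_gt0.
elim: t => // -[e g] x IHx y IHy; rewrite frag_node all_cat.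
by rewrite !E.
Qed.
End Cutting.

(** * Renumbering, contraction and contexts of trees *)

Section TreeOperations.
Variables (K : fieldType) (P : operad K).
Implicit Types (T : tree P) (c : child (tree P)) (s : seq (child (tree P))).

Definition renumber_child f c : child (tree P) :=
  match c with Leaf l => Leaf _ l | Edge e u => Edge (f e) (renumber f u) end.

Lemma renumberE f k (p : P k) s :
  renumber f (Vtx p s) = Vtx p (map (renumber_child f) s).
Proof. by []. Qed.

Lemma all_nth_children (a : pred (child (tree P))) s :
  (forall i, (i < size s)%N -> a (nth (Leaf _ 0) s i)) -> all a s.
Proof. by move=> H; apply/(all_nthP (Leaf _ 0)) => i /H. Qed.

Lemma perm_flatten_nth (f : child (tree P) -> seq nat)
    (g : child (tree P) -> seq nat) s :
  (forall i, (i < size s)%N ->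
     perm_eq (f (nth (Leaf _ 0) s i)) (g (nth (Leaf _ 0) s i))) ->
  perm_eq (flatten (map f s)) (flatten (map g s)).
Proof.
elim: s => //= c s IH H; rewrite perm_cat ?(H 0%N) ?IH // => i si.
exact: (H i.+1).
Qed.

Lemma leaves_renumber f T : leaves (renumber f T) = leaves T.
Proof.
elim/tree_ind_nth: T => k p s IH; rewrite renumberE !leavesE -map_comp.
congr flatten; rewrite -!map_nth_iota; apply: eq_map => i /=.
by case E: (nth _ s i) => [l|e u] //=; rewrite (IH _ _ _ E).
Qed.

Lemma edges_renumber f T : edges (renumber f T) = map f (edges T).
Proof.
elim/tree_ind_nth: T => k p s IH; rewrite renumberE !edgesE map_flatten -!map_comp.
congr flatten; rewrite -!map_nth_iota; apply: eq_map => i /=.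
by case E: (nth _ s i) => [l|e u] //=; rewrite (IH _ _ _ E).
Qed.

Lemma reduced_renumber f T : reduced (renumber f T) = reduced T.
Proof.
elim/tree_ind_nth: T => k p s IH; rewrite renumberE !reducedE size_map all_map.
congr [&& _, _ & _].
have allE a : all a s = all id (map a s) by rewrite all_map.
rewrite !allE -!map_nth_iota; congr all; apply: eq_map => i /=.
by case E: (nth _ s i) => [l|e u] //=; rewrite (IH _ _ _ E).
Qed.

Lemma contractP e T : reduced T -> uniq (edges T) ->
  [/\ reduced (contract e T), leaves (contract e T) = leaves T
    & perm_eq (edges (contract e T)) (filter (predC1 e) (edges T))].
Proof.
elim/tree_ind_nth: T => k p s IH rT uT.
have := rT; rewrite reducedE => /and3P[k1 /eqP sk rs].
have rn i : (i < size s)%N -> creduced (nth (Leaf _ 0) s i).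
  exact: (all_nthP (Leaf _ 0) rs).
have filter_id i : (i < size s)%N -> e \notin cedges (nth (Leaf _ 0) s i) ->
    filter (predC1 e) (cedges (nth (Leaf _ 0) s i)) = cedges (nth (Leaf _ 0) s i).
  move=> si ei; apply/all_filterP/allP => x xi /=.
  by apply: contraNneq ei => <-.
have [hs|hs] := boolP (has (is_edge e) s); last first.
  rewrite contract_hasN //.
  have IHn i : (i < size s)%N ->
      [/\ creduced (contract_child e (nth (Leaf _ 0) s i)),
          cleaves (contract_child e (nth (Leaf _ 0) s i)) = cleaves (nth (Leaf _ 0) s i)
        & perm_eq (cedges (contract_child e (nth (Leaf _ 0) s i)))
            (filter (predC1 e) (cedges (nth (Leaf _ 0) s i)))].
    move=> si; have := rn i si; have := uniq_cedges i uT.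
    have := all_nthP (Leaf _ 0) (_ : all (predC (is_edge e)) s) i si.
    rewrite all_predC hs => /(_ isT).
    case E: (nth _ s i) => [l|e' u] //= ee' /andP[_ uu] ru.
    have [ru' lu eu] := IH _ _ _ E ru uu; split=> //.
    by rewrite eq_sym (negPf ee') /= perm_cons.
  split.
  - rewrite reducedE size_map k1 sk eqxx all_map; apply: all_nth_children => i si /=.
    by have [] := IHn i si.
  - rewrite !leavesE -map_comp -!map_nth_iota; congr flatten.
    apply/eq_in_map => i; rewrite mem_iota => /andP[_ si] /=.
    by have [] := IHn i si.
  rewrite !edgesE filter_flatten -!map_comp.
  by apply: perm_flatten_nth => i si /=; have [] := IHn i si.
have [i [m [q [s' [nE ->]]]]] := contract_has rT hs.
have is_ : (i < size s)%N by rewrite sk.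
have ru : reduced (Vtx q s') by have := rn i is_; rewrite nE.
have := ru; rewrite reducedE => /and3P[m1 /eqP sm rs'].
have sE : s = take i s ++ Edge e (Vtx q s') :: drop i.+1 s.
  by rewrite -nE -drop_nth // cat_take_drop.
split.
- have rd : all (@creduced K P) (drop i.+1 s).
    by move: rs; rewrite {1}sE all_cat => /andP[_ /andP[]].
  have rt : all (@creduced K P) (take i s).
    by move: rs; rewrite {1}sE all_cat => /andP[].
  rewrite reducedE !all_cat rt rs' rd !size_cat size_take is_ size_drop sk sm !andbT.
  by have := ltn_ord i; lia.
- by rewrite !leavesE {3}sE !map_cat !flatten_cat.
pose A := flatten (map (@cedges K P) (take i s)).
pose B := edges (Vtx q s').
pose C := flatten (map (@cedges K P) (drop i.+1 s)).
have sABC : edges (Vtx p s) = A ++ (e :: B) ++ C.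
  by rewrite edgesE {1}sE map_cat flatten_cat.
have fid v : e \notin v -> filter (predC1 e) v = v.
  move=> eval_tree; apply/all_filterP/allP => x xv /=.
  by apply: contraNneq eval_tree => <-.
have := uT; rewrite sABC uniq_catCA cat_uniq => /and3P[/andP[eB _] /hasPn dis _].
have eAC x : x = e -> x \notin A ++ C.
  by move=> ->; apply/negP => /dis /=; rewrite inE eqxx.
have := eAC e erefl; rewrite mem_cat negb_or => /andP[eA eC].
rewrite edgesE !map_cat !flatten_cat !filter_cat /= eqxx /= !fid //.
Qed.

Lemma pmap_omitE i (es : seq nat) :
  pmap (omit i) es = map (unbump i) (filter (predC1 i) es).
Proof. by elim: es => //= e es ->; rewrite /omit; case: eqP. Qed.

Lemma is_tree_contract n j i T : is_tree n j.+1 T -> (i < j.+1)%N ->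
  is_tree n j (renumber (unbump i) (contract i T)).
Proof.
case/and3P=> rT lT eT ij.
have uT : uniq (edges T) by rewrite (perm_uniq eT) iota_uniq.
have [rc lc ec] := contractP i rT uT.
rewrite /is_tree reduced_renumber leaves_renumber edges_renumber rc lc lT /=.
apply: perm_trans (perm_map _ ec) _.
by rewrite -pmap_omitE; apply: pmap_omit.
Qed.

Fixpoint context_comp (C D : context P) : context P :=
  match C with
  | Hole => D
  | Above _ p s e C' s' => Above p s e (context_comp C' D) s'
  end.

Lemma fill_comp C D T : fill (context_comp C D) T = fill C (fill D T).
Proof. by elim: C => //= k p s e C -> s'. Qed.

Lemma reduced_fill C T : reduced (fill C T) -> reduced T.
Proof.
elim: C => //= k p s e C IH s' /and3P[_ _].
by rewrite all_cat /= => /and3P[_ /IH].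
Qed.

Lemma is_tree_fill n j C T T' : is_tree n j (fill C T) -> reduced T' ->
  perm_eq (leaves T') (leaves T) -> perm_eq (edges T') (edges T) ->
  is_tree n j (fill C T').
Proof.
move=> /and3P[rT lT eT] rT' lT' eT'.
suff [rC lC eC] : [/\ reduced (fill C T'),
    perm_eq (leaves (fill C T')) (leaves (fill C T))
  & perm_eq (edges (fill C T')) (edges (fill C T))].
  by apply/and3P; split; [|apply: perm_trans lC lT|apply: perm_trans eC eT].
elim: C rT {lT eT} => //= k p s e C IH s'.
rewrite -![_ && _]/(reduced (Vtx p _)) !reducedE !size_cat !all_cat /=.
move=> /and3P[-> ->] /and3P[-> /IH[-> lC eC] ->]; split=> //.
  by rewrite !map_cat !flatten_cat /= perm_cat2l perm_cat2r.
by rewrite !map_cat !flatten_cat /= perm_cat2l perm_cons perm_cat2r.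
Qed.

End TreeOperations.

(** * Expansion of cochains over cut trees *)

Section CutTrees.
Variable K : fieldType.
Local Notation P := (P_ne K).
Implicit Types (t u : mterm) (s : seq (child (tree P))).

Lemma reduced_cut_tree t : is_node t -> reduced (cut_tree K t).
Proof.
move=> nt; rewrite /cut_tree /vertex reducedE eqxx reduced_frag andbT.
case: t nt => // -[e g] x y _; rewrite frag_node size_cat !size_child_frag.
by rewrite andbT; apply: (@leq_add 1 1); apply: size_labels_gt0.
Qed.

Lemma is_tree_cut_tree n j t : valid n j t -> is_tree n j (cut_tree K t).
Proof.
case/and5P=> nt /eqP mt _ lt et; rewrite /is_tree reduced_cut_tree //.
by rewrite leaves_cut_tree lt edges_cut_tree -mt set_mark_mark.
Qed.

Lemma renumber_cut_tree f t :
  renumber f (cut_tree K t) = cut_tree K (map_marks (Some \o f) t).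
Proof.
have V r : renumber f (vertex r) = vertex (r.1, map (@renumber_child K P f) r.2).
  by rewrite /vertex renumberE size_map.
rewrite /cut_tree V; congr vertex.
elim: t => // -[e g] x IHx y IHy; rewrite [map_marks _ _]/= !frag_node.
have E v : ((frag K v).1, map (@renumber_child K P f) (frag K v).2)
      = frag K (map_marks (Some \o f) v) ->
    child_frag K (map_marks (Some \o f) v)
    = ((child_frag K v).1, map (@renumber_child K P f) (child_frag K v).2).
  rewrite /child_frag /cut mark_map_marks => <-; case: (mark v) => //= e'.
  by rewrite /vertex size_map.
by rewrite !E // /glue map_cat.
Qed.

(** The fragment of a subterm occupies a window in the list of children, whence [pre], [post] and
    the offset of [planar]. *)
Lemma eval_term_frag t pre post :
  eval_term (planar (size pre) (frag K t).1) (eval_children (pre ++ (frag K t).2 ++ post))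
  = fun kappa => kappa (set_mark None (nf t)).
Proof.
elim: t pre post => [l|[e g] x IHx y IHy] pre post.
  apply: funext => kappa /=.
  by rewrite /eval_children nth_cat ltnn subnn.
have E v : (forall pre post,
      eval_term (planar (size pre) (frag K v).1) (eval_children (pre ++ (frag K v).2 ++ post))
      = fun kappa => kappa (set_mark None (nf v))) ->
    forall pre post,
      eval_term (planar (size pre) (child_frag K v).1)
        (eval_children (pre ++ (child_frag K v).2 ++ post))
      = fun kappa => kappa (nf v).
  move=> IH pre' post'; rewrite /child_frag /cut; case mv: (mark v) => [e'|] /=.
    apply: funext => kappa; rewrite /eval_children nth_cat ltnn subnn.
    rewrite [nth _ _ _]/= /eval_child /vertex eval_treeE /planar_class eval_op_proj;
      last exact: eval_children_linear.
    rewrite eval_free_mon; last by apply: planar_multilinear; apply: size_frag.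
    have := IH [::] [::]; rewrite cats0 /= => ->.
    by rewrite set_mark_set_mark -mv -mark_nf set_mark_mark.
  by rewrite IH -mv -mark_nf set_mark_mark.
apply: funext => kappa; rewrite frag_node /=.
rewrite -catA (E x IHx) -size_child_frag -size_cat catA (E y IHy) set_mark_set_mark.
by rewrite -(mark_mul g (nf x) (nf y)) set_mark_mark.
Qed.

Lemma eval_tree_cut_tree t kappa :
  eval_tree (cut_tree K t) kappa = kappa (set_mark None (nf t)).
Proof.
rewrite /cut_tree /vertex eval_treeE /planar_class eval_op_proj;
      last exact: eval_children_linear.
rewrite eval_free_mon; last by apply: planar_multilinear; apply: size_frag.
by have := eval_term_frag t [::] [::]; rewrite cats0 => ->.
Qed.

Lemma eval_tree_cut_tree_valid n j t kappa : valid n j t ->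
  eval_tree (cut_tree K t) kappa = kappa t.
Proof.
by case/and5P=> _ /eqP mt nt _ _; rewrite eval_tree_cut_tree nf_id // -mt set_mark_mark.
Qed.

Lemma ext_permn k (w : term generator) : multilinear k w ->
  exists s : 'S_k, forall i, (i < k)%N -> permn s i = nth 0%N (labels w) i.
Proof.
move=> kw; have sw : size (labels w) = k by rewrite (perm_size kw) size_iota.
have lt_nth (i : 'I_k) : (nth 0%N (labels w) i < k)%N.
  by rewrite -(multilinearP _ kw) mem_nth ?sw.
pose f i := Ordinal (lt_nth i).
have f_inj : injective f.
  move=> i i' /(congr1 val) /= /eqP; rewrite nth_uniq ?sw //; last first.
    by rewrite (perm_uniq kw) iota_uniq.
  by move=> /eqP /val_inj.
exists (perm f_inj) => i ik.
by rewrite -[i in LHS]/(val (Ordinal ik)) permnE permE.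
Qed.

Section Expansion.
Variables (n j : nat) (phi : tree P -> K).
Hypothesis cochain_phi : cochain n j phi.

(** All contexts are included because subtrees get expanded in place, inside the whole tree on which
    [phi] is defined. *)
Definition expansion T := forall C, is_tree n j (fill C T) ->
  phi (fill C T) = eval_tree T (fun t => phi (fill C (cut_tree K t))).

(** The children are expanded from left to right, between fixed neighbours [s1] and [s2]. A product
    has the children of its factors, so expansions of consecutive segments concatenate. *)
Lemma expand_children C k (p : P k) s w s1 s2 :
  (forall i e T, nth (Leaf _ 0) s i = Edge e T -> expansion T) ->
  all (@creduced K P) s -> {in labels w, forall l, (l < size s)%N} ->
  is_tree n j
    (fill C (Vtx p (s1 ++ [seq nth (Leaf _ 0) s l | l <- labels w] ++ s2))) ->
  phi (fill C (Vtx p (s1 ++ [seq nth (Leaf _ 0) s l | l <- labels w] ++ s2)))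
  = eval_term w (eval_children s) (fun t => phi (fill C (Vtx p (s1 ++ (child_frag K t).2 ++ s2)))).
Proof.
move=> IH rs; elim: w s1 s2 => [l|g v IHv v' IHv'] s1 s2 ls.
  rewrite /= /eval_children; have := ls l; rewrite inE eqxx => /(_ isT) sl.
  have := all_nthP (Leaf _ 0) rs l sl; case E: (nth _ s l) => [l'|e u] //= ru.
  pose C' := context_comp C (Above p s1 e (Hole P) s2).
  have fE T : fill C (Vtx p (s1 ++ Edge e T :: s2)) = fill C' T.
    by rewrite fill_comp.
  rewrite fE => tu; rewrite (IH _ _ _ E) //; apply: (supported_eval_tree ru) => t [nt _ _].
  by rewrite child_frag_Some // -fE.
have lv : {in labels v, forall l, (l < size s)%N}.
  by move=> l lv; apply: ls; rewrite /= mem_cat lv.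
have lv' : {in labels v', forall l, (l < size s)%N}.
  by move=> l lv'; apply: ls; rewrite /= mem_cat lv' orbT.
rewrite [labels _]/= map_cat -catA => tT; rewrite IHv //.
apply: (@supported_eval_term _ _ _ (fun l => child_term (nth (Leaf _ 0) s l))).
  by move=> l /lv; apply: supported_eval_children.
move=> a Qa; have [na la ea] := terms_over_carried Qa.
have sa : size (child_frag K a).2 = size (labels v).
  rewrite size_child_frag.
  by have [|-> _] := @terms_over_same_class K _ _ _ _ Qa; move=> // l t [].
rewrite catA IHv' -?catA //.
  by congr eval_term; apply: funext => b; rewrite child_frag_mul2 -!catA.
(* Replacing the first segment by the children of [a] leaves a tree, with the same leaves and edges
   up to order. *)
have rT := reduced_fill (proj1 (andP tT)); apply: is_tree_fill tT _ _ _.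
- move: rT; rewrite !reducedE !size_cat !all_cat size_map sa.
  move=> /and3P[-> -> /and4P[-> _ -> ->]]; rewrite !andbT /=.
  rewrite /child_frag /cut; case ma: (mark a) => [e|]; last exact: reduced_frag.
  by rewrite [all _ _]/= andbT; apply: reduced_cut_tree; case: a ma {Qa na la ea sa}.
- rewrite !leavesE !map_cat !flatten_cat perm_cat2l perm_cat2r leaves_child_frag.
  by rewrite -map_comp.
rewrite !edgesE !map_cat !flatten_cat perm_cat2l perm_cat2r edges_child_frag.
by rewrite -map_comp.
Qed.

(** Linearity reduces the root decoration to a monomial [w]; equivariance makes it planar at the
    cost of reordering the children, which are then expanded. [terms_over_same_class] recognizes the
    result as a cut tree. *)
Lemma expand T : expansion T.
Proof.
elim/tree_ind_nth: T => k p s IH C tT.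
have rT := reduced_fill (proj1 (andP tT)).
have := rT; rewrite reducedE => /and3P[k1 /eqP sk rs].
have tree_decor (q : P k) : is_tree n j (fill C (Vtx q s)).
  by apply: (is_tree_fill (T' := Vtx q s) tT).
rewrite eval_treeE -[p]qliftK; move: (qlift p) => x.
rewrite eval_op_proj; last exact: eval_children_linear.
apply: (@linear_ext K generator k K^o
  (fun x => phi (fill C (Vtx (qproj (@relation_ne K) x : P k) s)))
  (fun x => eval_free x (eval_children s) (fun t => phi (fill C (cut_tree K t))))).
- by move=> a x' y'; rewrite qproj_linear (cochain_linear cochain_phi).
- exact: eval_free_linear.
move=> w kw; rewrite eval_free_mon //.
have [g gE] := ext_permn kw.
have nw : nleaves w = k by rewrite /nleaves (perm_size kw) size_iota.
have -> : (qproj (@relation_ne K) (mon K k w) : P k) = act g (planar_class K k w).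
  rewrite mon_class_act; last exact: planar_multilinear.
  by rewrite relabel_planar // => i iw; rewrite add0n gE -?nw.
rewrite (cochain_iso cochain_phi) //.
have -> : [seq nth (Leaf _ 0) s (g i) | i <- enum 'I_k]
    = [seq nth (Leaf _ 0) s l | l <- labels w].
  rewrite -[labels w in RHS](mkseq_nth 0%N) /mkseq -/(nleaves w) nw -val_enum_ord.
  by rewrite -!map_comp; apply: eq_map => i /=; rewrite -gE // permnE.
have tw : is_tree n j
    (fill C (Vtx (planar_class K k w) ([::] ++ [seq nth (Leaf _ 0) s l | l <- labels w] ++ [::]))).
  apply: is_tree_fill tT _ _ _; rewrite cats0.
  - rewrite reducedE k1 size_map -/(nleaves w) nw eqxx /=.
    rewrite all_map; apply/allP => l; rewrite (multilinearP _ kw) -sk => ls.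
    exact: (all_nthP (Leaf _ 0) rs).
  - rewrite !leavesE -map_comp -map_nth_iota sk; apply/perm_flatten/perm_map.
    exact: kw.
  rewrite !edgesE -map_comp -map_nth_iota sk; apply/perm_flatten/perm_map.
  exact: kw.
have lw : {in labels w, forall l, (l < size s)%N}.
  by move=> l; rewrite (multilinearP _ kw) sk.
have := expand_children (s1 := [::]) (s2 := [::]) IH rs lw tw.
rewrite cats0 => ->.
apply: (@supported_eval_term _ _ _ (fun l => child_term (nth (Leaf _ 0) s l))).
  by move=> l; rewrite (multilinearP _ kw) -sk; apply: supported_eval_children.
move=> t wt; rewrite cats0.
have [|nt mt] := terms_over_node _ wt; first by rewrite -/(nleaves w) nw.
have [|st Ht] := @terms_over_same_class K _ _ _ _ wt; first by move=> l u [].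
congr (phi (fill C _)); rewrite child_frag_None // in st Ht *.
rewrite /cut_tree /vertex size_frag st; move: Ht; rewrite st nw => /(_ k).
by move=> ->; rewrite ?st ?nw.
Qed.

End Expansion.
End CutTrees.

(** * Reduction to marked terms *)

Section Koszulness.
Variable K : fieldType.
Local Notation P := (P_ne K).
Implicit Types (T : tree P) (s : seq (child (tree P))) (phi psi : mterm -> K).

Lemma eval_children_slot s e T s' l :
  eval_children (s ++ Edge e T :: s') l
  = if l == size s then fun kappa => eval_tree T (fun t => kappa (set_mark (Some e) t))
    else eval_children (s ++ Leaf _ 0%N :: s') l.
Proof.
rewrite /eval_children !nth_cat; case: ltngtP => [//||->]; last by rewrite subnn.
by rewrite -subn_gt0; case: (l - size s)%N.
Qed.

Lemma eval_op_slot_linear k (p : P k) i (L L1 L2 : (mterm -> K) -> K) a rho kappa :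
  (i < k)%N -> (forall l, linear_form (rho l)) ->
  (forall kappa, L kappa = a * L1 kappa + L2 kappa) ->
  eval_op p (fun l => if l == i then L else rho l) kappa
  = a * eval_op p (fun l => if l == i then L1 else rho l) kappa
    + eval_op p (fun l => if l == i then L2 else rho l) kappa.
Proof.
move=> ik Lr LE; rewrite /eval_op /eval_free /extend mulr_sumr -big_split.
apply: eq_bigr => w _; have kw := valP w.
have uw : uniq (labels (val w)) by rewrite (perm_uniq kw) iota_uniq.
have iw : i \in labels (val w) by rewrite (multilinearP _ kw).
(* The combination is a sum over booleans, with coefficients [a] and 1. *)
have := @eval_term_sum K (val w) i bool [:: true; false] (fun b => if b then a else 1)
  (fun b => if b then L1 else L2) rho kappa Lr uw iw.
rewrite !big_cons big_nil addr0 mul1r.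
have -> : (fun k' => \sum_(b <- [:: true; false]) (if b then a else 1) *
  (if b then L1 else L2) k') = L.
  by apply: funext => k'; rewrite !big_cons big_nil addr0 mul1r LE.
move=> <-; rewrite /GRing.scale /=; set x := _ w.
by rewrite mulrDr mulrCA.
Qed.

Lemma eval_tree_fill_linear C T T1 T2 a kappa : reduced (fill C T) ->
  (forall kappa, eval_tree T kappa = a * eval_tree T1 kappa + eval_tree T2 kappa) ->
  eval_tree (fill C T) kappa = a * eval_tree (fill C T1) kappa + eval_tree (fill C T2) kappa.
Proof.
move=> + LT; elim: C kappa => [|k p s e C IH s'] kappa rC; first exact: LT.
rewrite [fill _ T]/= [fill _ T1]/= [fill _ T2]/= !eval_treeE.
have := rC; rewrite [fill _ _]/= reducedE size_cat /= all_cat => /and3P[_ /eqP sk].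
case/and3P => _ rT _.
have slotE T' : eval_children (s ++ Edge e T' :: s') = fun l => if l == size s
    then fun kappa => eval_tree T' (fun t => kappa (set_mark (Some e) t))
    else eval_children (s ++ Leaf _ 0%N :: s') l.
  by apply: funext => l; apply: eval_children_slot.
rewrite !slotE; apply: eval_op_slot_linear.
- by rewrite -sk -addSnnS leq_addr.
- exact: eval_children_linear.
by move=> k'; apply: IH.
Qed.

Lemma eval_tree_fill_eq C T T' :
  eval_tree T = eval_tree T' -> eval_tree (fill C T) = eval_tree (fill C T').
Proof.
move=> TT'; elim: C => [//|k p s e C IH s'].
rewrite [fill _ T]/= [fill _ T']/= !eval_treeE; congr eval_op; apply: funext => l.
by rewrite !eval_children_slot IH.
Qed.

Lemma eval_tree_act k (g : 'S_k) (p : P k) s :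
  eval_tree (Vtx (act g p) s)
  = eval_tree (Vtx p [seq nth (Leaf _ 0) s (g i) | i <- enum 'I_k]).
Proof.
rewrite !eval_treeE eval_op_act; last exact: eval_children_linear.
apply: funext => kappa; apply: eq_eval_op => l lk.
rewrite /eval_children /= -[l]/(val (Ordinal lk)) permnE.
rewrite (nth_map (Ordinal lk)) ?size_enum_ord //.
by rewrite nth_ord_enum.
Qed.

Lemma tree_term_valid n j T t : is_tree n j T -> tree_term T t -> valid n j t.
Proof.
case/and3P=> _ lT eT [nt mt [nrt lt et]]; rewrite /valid nt mt nrt /=.
by rewrite (perm_trans lt lT) (perm_trans et eT).
Qed.

Lemma eq_eval_tree n j T phi psi : is_tree n j T ->
  (forall t, valid n j t -> phi t = psi t) -> eval_tree T phi = eval_tree T psi.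
Proof.
move=> tT H; apply: supported_eval_tree; first by case/and3P: tT.
by move=> t /(tree_term_valid tT); apply: H.
Qed.

(** The converse of [expand]: functions on terms extend to cochains, because evaluation is well
    defined on [P_ne]. *)
Lemma cochain_eval_tree n j psi : alternating n j psi ->
  cochain n j (fun T : tree P => eval_tree T psi).
Proof.
move=> alt_psi; split.
- move=> C k a p q s tC; apply: eval_tree_fill_linear.
    have rC := reduced_fill (proj1 (andP tC)).
    by have /and3P[] := is_tree_fill (T' := Vtx (a *: p + q) s) tC rC
      (perm_refl _) (perm_refl _).
  by move=> kappa; rewrite !eval_treeE (eval_op_linear kappa (@eval_children_linear K s)).
- by move=> C k g p s _; rewrite (eval_tree_fill_eq C (eval_tree_act g p s)).
move=> g T tT; rewrite eval_tree_renumber -(linear_formZ _ _ (eval_tree_linear T)).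
by apply: (eq_eval_tree tT) => t vt; apply: alt_psi.
Qed.

(** Unmarking with [kill i] and closing the gap with [unbump i] is [omit i], so each contraction
    acts on expansions as a face. *)
Lemma cobar_eval_tree n j T psi : is_tree n j T ->
  \sum_(i < size (edges T)) (-1) ^+ i * eval_tree (renumber (unbump i) (contract i T)) psi
  = eval_tree T (delta j psi).
Proof.
move=> tT; have /and3P[rT _ eT] := tT.
have uT : uniq (edges T) by rewrite (perm_uniq eT) iota_uniq.
rewrite (perm_size eT) size_iota.
have -> : delta j psi = fun t => \sum_(i < j) (-1) ^+ i * psi (face i t) by [].
rewrite linear_form_sum; last exact: eval_tree_linear.
apply: eq_bigr => i _; congr (_ * _); rewrite eval_tree_renumber eval_tree_contract //.
congr eval_tree; apply: funext => t /=; congr psi.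
rewrite /face {1}/recut map_marks_nf map_marks_comp; apply: eq_recut => e _ /=.
by rewrite /kill /omit; case: eqP.
Qed.

Section Cochain.
Variables (n j : nat) (phi : tree P -> K).
Hypothesis cochain_phi : cochain n j phi.
Local Notation phi0 := (fun t : mterm => phi (cut_tree K t)).

Lemma phi_eval_tree T : is_tree n j T -> phi T = eval_tree T phi0.
Proof. exact: (expand cochain_phi (C := Hole P)). Qed.

Lemma alternating_cut : alternating n j phi0.
Proof.
move=> g t vt; rewrite -renumber_cut_tree (cochain_alt cochain_phi) //.
exact: is_tree_cut_tree.
Qed.

Lemma cocycle_cut : is_cocycle n j phi ->
  forall t, valid n j.+1 t -> delta j.+1 phi0 t = 0.
Proof.
move=> coc t vt; have tT := is_tree_cut_tree K vt.
rewrite -(eval_tree_cut_tree_valid (delta j.+1 phi0) vt) -(cobar_eval_tree phi0 tT).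
rewrite -[RHS](coc _ tT); apply: eq_bigr => i _; congr (_ * _).
rewrite -phi_eval_tree //; apply: (is_tree_contract tT).
by case/and3P: tT => _ _ /perm_size; rewrite size_iota => <-.
Qed.

End Cochain.
End Koszulness.

Theorem corollary12 (K : fieldType) : koszul (P_ne K).
Proof.
move=> n [|j] jn phi cochain_phi coc.
  move=> T tT; rewrite (phi_eval_tree cochain_phi tT) -(linear_form0 (eval_tree_linear T)).
  apply: (eq_eval_tree tT) => t vt.
  exact: (cocycle0 jn (alternating_cut cochain_phi) (cocycle_cut cochain_phi coc)).
have [psi alt_psi H] := cocycle_coboundary jn (alternating_cut cochain_phi)
  (cocycle_cut cochain_phi coc).
exists (fun T => eval_tree T psi); first exact: cochain_eval_tree.
move=> T tT; rewrite (phi_eval_tree cochain_phi tT) /cobar_d (cobar_eval_tree psi tT).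
exact: (eq_eval_tree tT).
Qed.
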